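(* Let $n\ge j\ge1$ and let $M$ be a compact manifold. The connecting map $\Omega\mathcal K_{n-1,j-1}\to\mathcal K_{n,j}$ of the fibration $\mathcal K_{n,j}\to\mathcal P_{n,j}\to\mathcal K_{n-1,j-1}$ is homotopic to $$\mathrm{gr}_1:\Omega\mathcal K_{n-1,j-1}\to\mathcal K_{n,j},\qquad f\longmapsto\big[(t_0,t_1,\dots,t_{j-1})\mapsto(t_0,f(t_0)(t_1,\dots,t_{j-1}))\big],$$ and the connecting map $\Omega\,\mathrm{EC}(j-1,M)\to\mathrm{EC}(j,M)$ of the fibration $\mathrm{EC}(j,M)\to\mathrm{PEC}(j,M)\to\mathrm{EC}(j-1,M)$ is homotopic to $$\mathrm{gr}_1:\Omega\,\mathrm{EC}(j-1,M)\to\mathrm{EC}(j,M),\qquad f\longmapsto\big[(t_0,t_1,\dots,t_{j-1},m)\mapsto(t_0,f(t_0)(t_1,\dots,t_{j-1},m))\big].$$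
   Context: $\mathbf I=[-1,1]$. All embedding spaces consist of $C^\infty$-smooth embeddings with the weak $C^\infty$-topology. $\mathcal K_{n,j}$ is the space of smooth embeddings $f:\mathbb R^j\to\mathbb R^n$ with $f(t)=(t,0,\dots,0)$ for $t\notin\mathbf I^j$ and $f(\mathbb R^j)\cap\partial\mathbf I^n=\partial\mathbf I^j\times\{0\}^{n-j}$; base-point the standard inclusion. $\mathcal P_{n,j}$ is the space of smooth embeddings $f:\mathbb R^j\to\mathbb R^n$ such that $f(t)=(t,0,\dots,0)$ for $t\notin[-1,\infty)\times\mathbf I^{j-1}$; there is $g\in\mathcal K_{n-1,j-1}$ with $f(t_1,\dots,t_j)=(t_1,g(t_2,\dots,t_j))$ for all $(t_1,\dots,t_j)\in[1,\infty)\times\mathbb R^{j-1}$; and $f(\mathbb R^j)\cap\partial\mathbf I^n=f(\partial\mathbf I^j)$. The fibration $\mathcal P_{n,j}\to\mathcal K_{n-1,j-1}$ is $f\mapsto g$. $\mathrm{EC}(j,M)$ is the space of smooth embeddings $f:\mathbb R^j\times M\to\mathbb R^j\times M$ with $\mathrm{supp}(f)=\{x:f(x)\ne x\}\subset\mathbf I^j\times M$ (boundary need not be sent to boundary); base-point the identity. $\mathrm{PEC}(j,M)$ is the space of smooth embeddings $f:\mathbb R^j\times M\to\mathbb R^j\times M$ with $\mathrm{supp}(f)\subset[-1,\infty)\times\mathbf I^{j-1}\times M$ for which there is $g\in\mathrm{EC}(j-1,M)$ with $f(t_1,\dots,t_j,m)=(t_1,g(t_2,\dots,t_j,m))$ for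 all $(t_1,\dots,t_j,m)\in[1,\infty)\times\mathbb R^{j-1}\times M$; the fibration $\mathrm{PEC}(j,M)\to\mathrm{EC}(j-1,M)$ is $f\mapsto g$. $\Omega X$ denotes the space of (smooth, for $X$ an embedding space) maps $f:\mathbb R\to X$ with $f(\mathbb R\setminus\mathbf I)=*$. Connecting map: for a fibration $p:E\to B$ with fibre inclusion $i:F\to E$ over the base-point of $B$, let $HF(i)=\{h:[0,1]\to E,\ h(0)\in F,\ h(1)=e\}$, $e\in F$ the base-point of $E$. Composition with $p$ gives a weak equivalence $HF(i)\to\Omega B$, and the connecting map $\Omega B\to F$ is the composite of its homotopy inverse with $h\mapsto h(0)$ (the direction of parametrisation of the path $h$ may be reversed: in the identification used here $HF(i)$ is taken as paths from the base-point of $E$ to a point of $F$). *)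

(* Defs.v *)
From HB Require Import structures.
From mathcomp Require Import all_boot all_order all_algebra.
From mathcomp Require Import all_classical all_reals all_analysis.

Set Implicit Arguments.
Unset Strict Implicit.
Unset Printing Implicit Defensive.

Import Order.TTheory GRing.Theory Num.Theory.
Import numFieldNormedType.Exports.

Local Open Scope classical_set_scope.
Local Open Scope ring_scope.

Section SmoothCoordinates.
Context {R : realType} {a b : nat}.
Implicit Types (U D : set 'rV[R]_a) (f g : 'rV[R]_a -> 'rV[R]_b).

Definition pder (s : seq 'I_a) f : 'rV[R]_a -> 'rV[R]_b :=
  foldr (fun i g => fun x => 'D_(delta_mx 0 i) g x) f s.

Definition Cinf_on U f :=
  forall s x, U x ->
    {for x, continuous (pder s f)} /\
    forall i, derivable (pder s f) x (delta_mx 0 i).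

Definition local_extension D f (x : 'rV[R]_a) g :=
  exists U, [/\ open U, U x, Cinf_on U g & forall y, U y -> D y -> g y = f y].

Definition smooth_on D f := forall x, D x -> exists g, local_extension D f x g.

(* When [D] is relatively open in R^a or in a half-space, [x] is in the closure
   of the interior of [D], so the derivatives at [x] of a smooth local
   extension of [f] do not depend on the extension. *)
Definition extension D f (x : 'rV[R]_a) : 'rV[R]_a -> 'rV[R]_b :=
  xget f [set g | local_extension D f x g].

End SmoothCoordinates.

Record chart (R : realType) (X : Type) (n : nat) := Chart {
  cdom : set X;
  cmap : X -> 'rV[R]_n;
  cinv : 'rV[R]_n -> X
}.

Definition cim (R : realType) (X : Type) (n : nat) (c : chart R X n) :
  set 'rV[R]_n := cmap c @` cdom c.

(* A family of charts; the axioms are in [manifold] below. *)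
Definition atlas (R : realType) (X : Type) (n : nat) := set (chart R X n).

(* The last coordinate is nonnegative; for n = 0 this is all of R^0. *)
Definition halfspace (R : realType) (n : nat) : set 'rV[R]_n :=
  [set x | forall i : 'I_n, i.+1 = n -> 0 <= x 0 i].
Arguments halfspace : clear implicits.

Definition model_open (R : realType) (n : nat) (D : set 'rV[R]_n) :=
  exists2 O : set 'rV[R]_n, open O & D = O \/ D = O `&` halfspace R n.

Definition euclid (R : realType) (n : nat) : atlas R 'rV[R]_n n :=
  [set Chart setT id id].
Arguments euclid : clear implicits.

Definition real_line (R : realType) : atlas R R 1 :=
  [set Chart setT (fun t : R => t%:M) (fun v : 'rV[R]_1 => v 0 0)].
Arguments real_line : clear implicits.

Definition prod_chart (R : realType) (X Y : Type) (a b : nat)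
    (c : chart R X a) (d : chart R Y b) : chart R (X * Y)%type (a + b) :=
  Chart (cdom c `*` cdom d)
        (fun p => row_mx (cmap c p.1) (cmap d p.2))
        (fun v => (cinv c (lsubmx v), cinv d (rsubmx v))).

(* Only used with a first factor without boundary: the half-space condition is
   on the last coordinate, so no corners appear. *)
Definition prod_atlas (R : realType) (X Y : Type) (a b : nat)
    (A : atlas R X a) (B : atlas R Y b) : atlas R (X * Y)%type (a + b) :=
  [set prod_chart c d | c in A & d in B].

Section SmoothMaps.
Context {R : realType} {X Y : topologicalType} {a b : nat}.
Variables (A : atlas R X a) (B : atlas R Y b).

Definition rep_dom (c : chart R X a) (d : chart R Y b) (f : X -> Y) :
  set 'rV[R]_a := cim c `&` [set x | cdom d (f (cinv c x))].

Definition rep (c : chart R X a) (d : chart R Y b) (f : X -> Y) :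
  'rV[R]_a -> 'rV[R]_b := fun x => cmap d (f (cinv c x)).

Definition rep_ext c d f (x : 'rV[R]_a) : 'rV[R]_a -> 'rV[R]_b :=
  extension (rep_dom c d f) (rep c d f) x.

Definition smooth (f : X -> Y) :=
  continuous f /\
  forall c d, A c -> B d -> smooth_on (rep_dom c d f) (rep c d f).

Definition immersion (f : X -> Y) :=
  forall c d, A c -> B d -> forall x, rep_dom c d f x ->
    injective ('d (rep_ext c d f x) x).

Definition topological_embedding (f : X -> Y) :=
  injective f /\
  forall U : set X, open U -> exists2 V : set Y, open V & U = f @^-1` V.

Definition smooth_embedding (f : X -> Y) :=
  [/\ smooth f, immersion f & topological_embedding f].

(* Maps that are [e]-close to [f] in the charts [c], [d], with all partial
   derivatives of order at most [r], uniformly on the compact set [K]. *)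
Definition weak_subbasic (f : X -> Y) (c : chart R X a) (d : chart R Y b)
    (K : set X) (r : nat) (e : R) : set (X -> Y) :=
  [set g | forall x, K x -> cdom d (g x) /\
     forall s : seq 'I_a, (size s <= r)%N ->
       `| pder s (rep_ext c d g (cmap c x)) (cmap c x) -
          pder s (rep_ext c d f (cmap c x)) (cmap c x) | < e].

Definition weak_subbase : set (set (X -> Y)) :=
  [set W | exists f c d K r e,
     [/\ smooth f, A c, B d & 0 < e] /\
     [/\ compact K, K `<=` cdom c, f @` K `<=` cdom d &
         W = weak_subbasic f c d K r e]].

(* The carrier contains all maps; only its subsets consisting of smooth maps
   are used, and there this is the weak C^oo topology. *)
Definition weakCinf : Type := let _ := (A, B) in X -> Y.

HB.instance Definition _ := Choice.copy weakCinf (X -> Y).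
HB.instance Definition _ :=
  isSubBaseTopological.Build weakCinf weak_subbase id.

End SmoothMaps.

Definition manifold (R : realType) (M : topologicalType) (k : nat)
    (A : atlas R M k) :=
  [/\ hausdorff_space M, @second_countable M,
      forall x : M, exists2 c, A c & cdom c x,
      forall c, A c ->
        [/\ open (cdom c), {within cdom c, continuous (cmap c)},
            model_open (cim c), {within cim c, continuous (cinv c)} &
            {in cdom c, cancel (cmap c) (cinv c)}] &
      forall c d, A c -> A d -> smooth_on (rep_dom c d id) (rep c d id)].

Definition compact_manifold (R : realType) (M : topologicalType) (k : nat)
    (A : atlas R M k) := manifold A /\ compact [set: M].

Definition homotopic (R : realType) (S T : topologicalType)
    (A : set S) (B : set T) (f g : S -> T) :=
  exists H : R * S -> T,
    [/\ {within `[0, 1] `*` A, continuous H},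
        forall t x, t \in `[0, 1] -> A x -> B (H (t, x)),
        forall x, A x -> H (0, x) = f x &
        forall x, A x -> H (1, x) = g x].

(* [p : E -> B] is a fibration with fibre [F] over [b]; [E], [F] and [B] are
   subspaces of [TE] and [TB]. *)

Section ConnectingMap.
Context {R : realType} {TE TB : topologicalType}.
Variables (E F : set TE) (e : TE) (B : set TB) (b : TB) (p : TE -> TB).

Definition loops : set {compact-open, R -> TB} :=
  [set l | [/\ continuous (l : R -> TB), forall t, B (l t) &
               forall t, t \notin `[-1, 1] -> l t = b]].

(* Paths [0,1] -> E from the base-point to a point of the fibre, extended to R
   by constants. *)
Definition homotopy_fibre : set {compact-open, R -> TE} :=
  [set h | [/\ continuous (h : R -> TE), forall t, E (h t),
               forall t, t <= 0 -> h t = e,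
               forall t, 1 <= t -> h t = h 1 & F (h 1)]].

(* [0,1] is identified with [-1,1] by the increasing affine map. *)
Definition project_path (h : {compact-open, R -> TE}) :
  {compact-open, R -> TB} := fun t => p (h ((t + 1) / 2)).

(* [s] is a homotopy inverse of [project_path]; [d] is determined up to
   homotopy. *)
Definition connecting_map (d : {compact-open, R -> TB} -> TE) :=
  exists s : {compact-open, R -> TB} -> {compact-open, R -> TE},
    [/\ {within loops, continuous s} /\
          (forall l, loops l -> homotopy_fibre (s l)),
        homotopic R loops loops (project_path \o s) id,
        homotopic R homotopy_fibre homotopy_fibre (s \o project_path) id &
        forall l, loops l -> d l = s l 1].

End ConnectingMap.

(* Loops R -> S in a space S of smooth maps X -> Y, smooth in the sense that
   the adjoint R x X -> Y is smooth, with the weak topology of the adjoints. *)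
Definition smooth_loops (R : realType) (X Y : topologicalType) (a b : nat)
    (A : atlas R X a) (B : atlas R Y b)
    (S : set (weakCinf A B)) (f0 : weakCinf A B) :
    set (weakCinf (prod_atlas (real_line R) A) B) :=
  [set l | [/\ smooth (prod_atlas (real_line R) A) B l,
               forall t : R, S (fun x => l (t, x)) &
               forall t : R, t \notin `[-1, 1] -> (fun x => l (t, x)) = f0]].

Definition loop_of (R : realType) (X Y : topologicalType) (a b : nat)
    (A : atlas R X a) (B : atlas R Y b)
    (l : weakCinf (prod_atlas (real_line R) A) B) :
    {compact-open, R -> weakCinf A B} :=
  fun t x => l (t, x).

Section Euclidean.
Context {R : realType}.

Definition rcons1 n (t : R) (u : 'rV[R]_n) : 'rV[R]_n.+1 :=
  row_mx (t%:M : 'rV[R]_1) u.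

Definition rhead n (x : 'rV[R]_n.+1) : R := x 0 0.

Definition rtail n (x : 'rV[R]_n.+1) : 'rV[R]_n :=
  @rsubmx R 1 1 n x.

Definition cube n : set 'rV[R]_n := [set x | forall i, `|x 0 i| <= 1].

(* For n = 0, the boundary of the point I^0 is empty. *)
Definition cube_boundary n : set 'rV[R]_n :=
  [set x | cube x /\ exists i, `|x 0 i| = 1].

(* t |-> (t, 0, ..., 0), used for j <= n *)
Definition std_incl n j (t : 'rV[R]_j) : 'rV[R]_n := t *m pid_mx j.

End Euclidean.

Arguments cube {R n} _.
Arguments cube_boundary R n _ : clear implicits.
Arguments std_incl {R} n {j} _.

Section LongKnots.
Variable R : realType.

Notation Emb n j := (weakCinf (euclid R j) (euclid R n)).

Definition K_base n j : Emb n j := @std_incl R n j.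

Definition K_ n j : set (Emb n j) :=
  [set f | [/\ smooth_embedding (euclid R j) (euclid R n) f,
               forall t, ~ cube t -> f t = std_incl n t &
               range f `&` cube_boundary R n
                 = std_incl n @` cube_boundary R j]].

(* P_ n j is P_{n+1,j+1}, which fibres over K_{n,j}. *)
Definition P_ n j : set (Emb n.+1 j.+1) :=
  [set f | [/\ smooth_embedding (euclid R j.+1) (euclid R n.+1) f,
               forall t, ~ (-1 <= rhead t /\ cube (rtail t)) ->
                 f t = std_incl n.+1 t,
               exists2 g, K_ g &
                 forall t u, 1 <= t -> f (rcons1 t u) = rcons1 t (g u) &
               range f `&` cube_boundary R n.+1
                 = f @` cube_boundary R j.+1]].

(* The map g in the definition of [P_] is read off at t_1 = 1. *)
Definition P_proj n j (f : Emb n.+1 j.+1) : Emb n j :=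
  fun u => rtail (f (rcons1 1 u)).

Definition K_gr1 n j
    (l : weakCinf (prod_atlas (real_line R) (euclid R j)) (euclid R n)) :
    Emb n.+1 j.+1 :=
  fun x => rcons1 (rhead x) (l (rhead x, rtail x)).

End LongKnots.

Arguments K_base : clear implicits.
Arguments K_ : clear implicits.
Arguments P_ : clear implicits.
Arguments P_proj : clear implicits.
Arguments K_gr1 : clear implicits.

Section CubicallySupported.
Context {R : realType} {M : topologicalType} {k : nat}.
Variable A : atlas R M k.

Notation RM j := (prod_atlas (euclid R j) A).
Notation End_ j := (weakCinf (RM j) (RM j)).

Definition EC_base j : End_ j := id.

Definition EC j : set (End_ j) :=
  [set f | smooth_embedding (RM j) (RM j) f /\
           forall x, f x <> x -> cube x.1].

(* PEC j is PEC(j+1,M), which fibres over EC(j,M). *)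
Definition PEC j : set (End_ j.+1) :=
  [set f | [/\ smooth_embedding (RM j.+1) (RM j.+1) f,
               forall x, f x <> x -> -1 <= rhead x.1 /\ cube (rtail x.1) &
               exists2 g, EC g &
                 forall t u m, 1 <= t ->
                   f (rcons1 t u, m) =
                   (rcons1 t (g (u, m)).1, (g (u, m)).2)]].

Definition PEC_proj j (f : End_ j.+1) : End_ j :=
  fun y => let z := f (rcons1 1 y.1, y.2) in (rtail z.1, z.2).

Definition EC_gr1 j (l : weakCinf (prod_atlas (real_line R) (RM j)) (RM j)) :
    End_ j.+1 :=
  fun x => let z := l (rhead x.1, (rtail x.1, x.2)) in
           (rcons1 (rhead x.1) z.1, z.2).

End CubicallySupported.

Arguments EC_base {R M k} A j _.
Arguments EC {R M k} A j _.
Arguments PEC {R M k} A j _.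
Arguments PEC_proj {R M k} A j _.
Arguments EC_gr1 {R M k} A j _.

(* Main.v *)
(* A loop of embeddings l : R -> K lifts along the fibration to the path
   z |-> [(t, x) |-> (t, l (phi_z t) x)], where phi_z t = -1 + 2 z s(t) for a
   smooth step s from 0 to 1 on [-1, 1]: for t <= -1 this is the base-point, for
   t >= 1 it is the constant l (2 z - 1), and at z = 1 it is the graph of the
   reparametrized loop l \o phi_1. So the connecting map sends l to gr_1 (l \o phi_1)
   up to the homotopy that makes the chosen homotopy inverse an inverse, and the
   affine homotopy from phi_1 to the identity leads to gr_1 l.

   What needs work is that (z, l) |-> [(t, x) |-> (t, l (phi_z t) x)] is jointly
   continuous for the weak topologies: its jets are finite sums of smooth
   functions of (z, t) times jets of l, and evaluating jets is jointly
   continuous. The values are embeddings because they are injective proper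
   immersions. *)
From HB Require Import structures.
Require Import Defs.
From mathcomp Require Import all_boot all_order all_algebra.
From mathcomp Require Import all_classical all_reals all_analysis.
From mathcomp Require Import finmap ring lra.
Import numFieldNormedType.Exports.
Set Implicit Arguments.
Unset Strict Implicit.
Unset Printing Implicit Defensive.
Import Order.TTheory GRing.Theory Num.Theory.
Local Open Scope classical_set_scope.
Local Open Scope ring_scope.

(** * Partial derivatives *)

(** Jets are read from local extensions that [xget] picks point by point, since charts of M may end
    at a boundary; they are independent of that choice, and continuous in the point, because chart
    images lie in the closure of their interior ([fat]). The weak topology compares jets on compact
    sets inside one chart, which is not yet a statement about joint limits. Local compactness of R x
    X gives joint continuity of evaluation ([jet_eval_cvg]); compactness of the test set turns joint
    convergence of jets near each point into weak convergence ([cvg_weakCinf_jets]). The parameter z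
    is merely topological: paths must be constant outside [0,1], and the cut-off [clamp] is not
    differentiable. For knots the delicate condition is the one on the boundary of the cube. A graph
    meets it in the right set only if each l(t) maps the open cube into the open cube, which the
    definition of K does not state; it follows by tracking a point along the loop from the
    base-point. Both fibrations are instances of one argument, in which R^(j+1) and R^(j+1) x M are
    presented as R x X. *)

Section PartialDerivatives.
Context {R : realType} {a b : nat}.
Implicit Types (U D : set 'rV[R]_a) (f g : 'rV[R]_a -> 'rV[R]_b).

Lemma pder_eq_open U f g : open U -> (forall x, U x -> f x = g x) ->
  forall s x, U x -> pder s f x = pder s g x.
Proof.
move=> oU fg; elim=> [|i s IH] x Ux /=; first exact: fg.
apply: near_eq_derive; near=> y; apply: IH; near: y.
exact: open_nbhs_nbhs.
Unshelve. all: by end_near. Qed.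

End PartialDerivatives.

(** * Directional derivatives and differentiability of C^1 maps *)

Section Differentiability.
Context {R : realType}.

(** The mean value theorem on the segment between 0 and [h], for either sign of [h]. It bounds the
    error made by one coordinate step in [C1_differentiable]. *)
Lemma MVT_norm (f df : R -> R) (K L : R) (h : R) :
  (forall t : R, `|t| <= `|h| -> is_derive t 1 f (df t)) ->
  (forall t : R, `|t| <= `|h| -> `|df t - L| <= K) ->
  `|f h - f 0 - h * L| <= `|h| * K.
Proof.
move=> fd dfK.
have H x y : x < y -> (forall t, x <= t <= y -> `|t| <= `|h|) ->
    exists2 c, `|c| <= `|h| & f y - f x = df c * (y - x).
  move=> xy Hxy.
  have dd t : t \in `]x, y[%R -> is_derive t 1 f (df t).
    by rewrite in_itv/= => /andP[/ltW ? /ltW ?]; apply/fd/Hxy/andP.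
  have cc : {within `[x, y], continuous f}.
    apply: derivable_within_continuous => t; rewrite in_itv/= => /Hxy/fd df1.
    exact: ex_derive.
  have [c] := MVT xy dd cc; rewrite in_itv/= => /andP[/ltW ? /ltW ?] E.
  by exists c => //; apply/Hxy/andP.
have K0 : 0 <= K by apply: le_trans (dfK 0 _); rewrite ?normr0.
have [h0|h0|->] := ltgtP h 0.
- have [|c ch E] := H h 0 h0.
    by move=> t /andP[h1 h2]; rewrite (ler0_norm h2) (ltr0_norm h0) lerN2.
  have -> : f h - f 0 - h * L = h * (df c - L) by move: E; lra.
  by rewrite normrM ler_wpM2l// dfK.
- have [|c ch E] := H 0 h h0.
    by move=> t /andP[h1 h2]; rewrite (ger0_norm h1) (gtr0_norm h0).
  have -> : f h - f 0 - h * L = h * (df c - L) by move: E; lra.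
  by rewrite normrM ler_wpM2l// dfK.
- by rewrite subrr mul0r subrr normr0 mul0r.
Qed.


(** The two difference quotients are the same function. Together with [is_derive_lineP] this moves
    between directional derivatives and one-variable calculus along a line. *)
Lemma is_derive_line (V W : normedModType R) (f : V -> W) (p v : V) (t : R) :
  derivable f (t *: v + p) v ->
  is_derive t 1 (fun s : R => f (s *: v + p)) ('D_v f (t *: v + p)).
Proof.
move=> df.
have E : (fun h : R => h^-1 *: (f ((h *: (1 : R) + t) *: v + p) - f (t *: v + p)))
   = (fun h => h^-1 *: (f (h *: v + (t *: v + p)) - f (t *: v + p))).
  by apply/funext => h; rewrite -{1}[h]mulr1 scalerDl addrA [h *: 1]mulr1 mulr1.
by split; [rewrite /derivable /= E | rewrite /derive /= E].
Qed.

Lemma is_derive_coord (V : normedModType R) m n (F : V -> 'M[R]_(m, n)) x v (dF : 'M[R]_(m, n)) i j :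
  is_derive x v F dF -> is_derive x v (fun y => F y i j) (dF i j).
Proof.
move=> [dF1 <-]; split; first by move/derivable_mxP : dF1; exact.
by rewrite derive_mx// mxE.
Qed.

Lemma is_derive_mx (V : normedModType R) m n (F : V -> 'M[R]_(m, n)) x v (dF : 'M[R]_(m, n)) :
  (forall i j, is_derive x v (fun y => F y i j) (dF i j)) ->
  is_derive x v F dF.
Proof.
move=> H; have D : derivable F x v.
  by apply/derivable_mxP => i j; exact: ex_derive.
split => //; rewrite derive_mx//; apply/matrixP => i j; rewrite mxE.
exact: derive_val.
Qed.

Lemma le_coord_norm m n (A : 'M[R]_(m, n)) i j : `|A i j| <= `|A|.
Proof.
rewrite [leRHS]/Num.Def.normr/= mx_normrE.
exact: (le_bigmax _ _ (i, j)).
Qed.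

Lemma mx_norm_le m n (A : 'M[R]_(m, n)) (e : R) :
  0 <= e -> (forall i j, `|A i j| <= e) -> `|A| <= e.
Proof.
move=> e0 H; rewrite [leLHS]/Num.Def.normr/= mx_normrE.
by apply: bigmax_le => // -[i j] _; exact: H.
Qed.

Lemma mulmxr_continuous a b (B : 'M[R]_(a, b)) :
  continuous (fun x : 'rV[R]_a => x *m B).
Proof.
move=> x; apply/(@cvgrPdist_le _ _ _ (nbhs x)) => e e0.
(* The summand 1 keeps [C] positive when the rows of [B] vanish, so that division by [C] is
   allowed. *)
pose C := 1 + \sum_i `|row i B|.
have C0 : 0 < C by rewrite ltr_pwDl// sumr_ge0.
near=> y; rewrite -mulmxBl mulmx_sum_row (le_trans (ler_norm_sum _ _ _))//.
apply: (@le_trans _ _ (`|x - y| * C)); last first.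
  rewrite -ler_pdivlMr//; near: y; apply: cvgr_dist_le; first exact: cvg_id.
  by rewrite divr_gt0.
rewrite mulrDr mulr1 mulr_sumr ler_wpDl// ler_sum// => i _.
by rewrite normrZ ler_wpM2r// le_coord_norm.
Unshelve. all: by end_near. Qed.

Lemma diff_of_estimate (V W : normedModType R) (f : V -> W)
    (L : {linear V -> W}) (x : V) :
  continuous L ->
  (forall e, 0 < e ->
     \forall h \near (0 : V), `|f (h + x) - f x - L h| <= e * `|h|) ->
  differentiable f x /\ 'd f x = L :> (V -> W).
Proof.
move=> cL H.
have fo : f \o shift x = cst (f x) + L +o_ 0 id.
  apply/eqaddoP => e e0; near=> h.
  rewrite /= -[X in `|X|]/(f (h + x) - (f x + L h)) opprD addrA.
  by near: h; exact: H.
have dE := diff_unique cL fo.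
by split => //; apply/diff_locallyP; rewrite dE.
Unshelve. all: by end_near. Qed.

(** Go from [x] to [h + x] by changing one coordinate at a time and apply the mean value theorem to
    each step; this is done for each component of [f] separately, since that theorem is for real
    values. *)
Lemma C1_differentiable a b (f : 'rV[R]_a -> 'rV[R]_b) (x : 'rV[R]_a) :
  (\forall y \near x, forall i, derivable f y (delta_mx 0 i)) ->
  (forall i, {for x, continuous (fun y => 'D_(delta_mx 0 i) f y)}) ->
  differentiable f x /\
  forall v, 'd f x v = \sum_i v 0 i *: 'D_(delta_mx 0 i) f x.
Proof.
move=> df cf.
pose J : 'M[R]_(a, b) := \matrix_(i, j) 'D_(delta_mx 0 i) f x 0 j.
pose L : {linear 'rV[R]_a -> 'rV[R]_b} := mulmxr J.
have cL : continuous L by exact: mulmxr_continuous.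
have [dfx dE] : differentiable f x /\ 'd f x = L :> (_ -> _).
  apply: diff_of_estimate => // e e0.
  (* Each of the [a] steps costs at most [|h| * K]; dividing by [a.+1] keeps the denominator nonzero
     for [a = 0]. *)
  pose K := e / a.+1%:R.
  have K0 : 0 < K by rewrite divr_gt0.
  have cfK : \forall y \near x, forall i,
      `|'D_(delta_mx 0 i) f y - 'D_(delta_mx 0 i) f x| <= K.
    apply: (@filter_forall _ _ _ (nbhs x)) => i.
    have /cvgrPdist_le /(_ _ K0) := cf i.
    by apply: filterS => y; rewrite distrC.
  have [r /= r0 rP] := (nbhs_ballP _ _).1 (filterI df cfK).
  apply: filterS (@nbhs0_lt _ ('rV[R]_a : normedModType R) r r0) => h hr.
  rewrite /= -addrA -opprD.
  apply: mx_norm_le; first by rewrite mulr_ge0// ltW.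
  move=> i0 j; rewrite (ord1 i0) {i0}.
  (* The corners of the path from 0 to [h]: the first [m] coordinates have already been changed. *)
  pose hm m : 'rV[R]_a := \row_i (if (i < m)%N then h 0 i else 0).
  have hm0 : hm 0%N = 0 by apply/rowP => i; rewrite !mxE.
  have hma : hm a = h by apply/rowP => i; rewrite !mxE ltn_ord.
  pose L' (i : 'I_a) := 'D_(delta_mx 0 i) f x 0 j.
  have step (i : 'I_a) :
      `|f (hm i.+1 + x) 0 j - f (hm i + x) 0 j - h 0 i * L' i| <= `|h| * K.
    pose e_i : 'rV[R]_a := delta_mx 0 i.
    pose u (t : R) := f (t *: e_i + (hm i + x)) 0 j.
    have -> : f (hm i.+1 + x) 0 j = u (h 0 i).
      rewrite /u addrA; congr (f (_ + x) 0 j); apply/rowP => k.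
      rewrite !mxE /= ltnS leq_eqVlt [k == i]eq_sym.
      have [->|ki] := eqVneq k i; first by rewrite eqxx ltnn mulr1 addr0.
      by rewrite mulr0 add0r eq_sym (inj_eq val_inj) eq_sym (negbTE ki).
    have -> : f (hm i + x) 0 j = u 0 by rewrite /u scale0r add0r.
    have near_x t : `|t| <= `|h 0 i| -> ball x r (t *: e_i + (hm i + x)).
      move=> tx; rewrite -ball_normE /= addrA opprD addrCA subrr addr0 normrN.
      apply: le_lt_trans hr; apply: mx_norm_le => // i0 k; rewrite (ord1 i0) !mxE /=.
      have [->|ki] := eqVneq k i.
        by rewrite ltnn mulr1 addr0 (le_trans tx)// le_coord_norm.
      by rewrite mulr0 add0r; case: ifP => _; rewrite ?normr0// le_coord_norm.
    apply: le_trans (_ : _ <= `|h 0 i| * K) _; last first.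
      by rewrite ler_wpM2r ?le_coord_norm// ltW.
    apply: (@MVT_norm u (fun t => 'D_e_i f (t *: e_i + (hm i + x)) 0 j)).
      move=> t /near_x /rP[/(_ i) d1 _]; rewrite /u.
      exact/is_derive_coord/is_derive_line.
    move=> t /near_x /rP[_ /(_ i)]; apply: le_trans.
    by apply: le_trans (le_coord_norm _ 0 j); rewrite !mxE.
  rewrite !mxE.
  have -> : f (h + x) 0 j - (f x 0 j + \sum_k h 0 k * J k j) =
      \sum_(i < a) (f (hm i.+1 + x) 0 j - f (hm i + x) 0 j - h 0 i * L' i).
    rewrite sumrB -(big_mkord xpredT (fun i => f (hm i.+1 + x) 0 j - f (hm i + x) 0 j)).
    rewrite telescope_sumr// hma hm0 add0r opprD addrA; congr (_ - _).
    by apply: eq_bigr => k _; rewrite mxE.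
  apply: (le_trans (ler_norm_sum _ _ _)).
  apply: le_trans (ler_sum _ (fun i _ => step i)) _.
  rewrite sumr_const card_ord -[_ *+ a]mulr_natr -mulrA [e * _]mulrC.
  rewrite ler_wpM2l// /K mulrAC ler_pdivrMr//.
  by rewrite ler_wpM2l ?(ltW e0)// ler_nat.
split => // v; rewrite dE /= mulmx_sum_row; apply: eq_bigr => i _; congr (_ *: _).
by apply/rowP => j; rewrite !mxE.
Qed.

End Differentiability.

(** * Rows split into first coordinate and tail *)

Section Rows.
Context {R : realType} {n : nat}.
Implicit Types (t s : R) (u v : 'rV[R]_n) (x y : 'rV[R]_n.+1).

Lemma rcons1_0 t u : rcons1 t u 0 ord0 = t.
Proof.
transitivity ((t%:M : 'rV[R]_1) 0 0); last by rewrite mxE.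
rewrite -(row_mxEl (t%:M : 'rV[R]_1) u 0 0) /rcons1.
by congr (_ 0 _); apply/val_inj.
Qed.

Lemma rcons1_lift t u i : rcons1 t u 0 (lift ord0 i) = u 0 i.
Proof.
rewrite -(row_mxEr (t%:M : 'rV[R]_1) u 0 i) /rcons1.
by congr (_ 0 _); apply/val_inj.
Qed.

Lemma rcons1_rect x y : x 0 ord0 = y 0 ord0 ->
  (forall i, x 0 (lift ord0 i) = y 0 (lift ord0 i)) -> x = y.
Proof. by move=> H0 H; apply/rowP => i; case: (unliftP ord0 i) => [j|] ->. Qed.

Lemma rtailE x i : rtail x 0 i = x 0 (lift ord0 i).
Proof. by rewrite /rtail mxE; congr (x _ _); apply: val_inj. Qed.

Lemma rcons1K t u : rhead (rcons1 t u) = t.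
Proof. exact: rcons1_0. Qed.

Lemma rtail_rcons1 t u : rtail (rcons1 t u) = u.
Proof. by apply/rowP => i; rewrite rtailE rcons1_lift. Qed.

Lemma rcons1_eta x : rcons1 (rhead x) (rtail x) = x.
Proof. by apply: rcons1_rect => [|i]; rewrite ?rcons1_0// rcons1_lift rtailE. Qed.

Lemma rcons1D t s u v : rcons1 t u + rcons1 s v = rcons1 (t + s) (u + v).
Proof.
by apply: rcons1_rect => [|i]; rewrite mxE ?rcons1_0// !rcons1_lift mxE.
Qed.

Lemma rcons1Z c t u : c *: rcons1 t u = rcons1 (c * t) (c *: u).
Proof.
by apply: rcons1_rect => [|i]; rewrite mxE ?rcons1_0// !rcons1_lift mxE.
Qed.

Lemma delta_ord0 : delta_mx 0 ord0 = rcons1 1 0 :> 'rV[R]_n.+1.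
Proof.
apply: rcons1_rect => [|i]; rewrite mxE ?rcons1_0// rcons1_lift mxE /=.
by [].
Qed.

Lemma delta_lift i : delta_mx 0 (lift ord0 i) = rcons1 0 (delta_mx 0 i) :> 'rV[R]_n.+1.
Proof.
apply: rcons1_rect => [|j]; first by rewrite mxE rcons1_0.
by rewrite rcons1_lift !mxE !eqxx (inj_eq lift_inj).
Qed.

Lemma cvg_mx {T : Type} {F : set_system T} {FF : Filter F} m p
    (f : T -> 'M[R]_(m, p)) (A : 'M[R]_(m, p)) :
  (forall i j, f x i j @[x --> F] --> A i j) -> f @ F --> A.
Proof.
move=> H; apply/(@cvgrPdist_le _ _ _ F) => e e0.
have : \forall x \near F, forall i j, `|A i j - f x i j| <= e.
  apply: filter_forall => i; apply: filter_forall => j.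
  by have /cvgrPdist_le := H i j; exact.
apply: filterS => x Hx; apply: mx_norm_le; first exact: ltW.
by move=> i j; rewrite !mxE.
Qed.

Lemma cvg_coord {T : Type} {F : set_system T} {FF : Filter F} m p
    (f : T -> 'M[R]_(m, p)) (A : 'M[R]_(m, p)) i j :
  f @ F --> A -> f x i j @[x --> F] --> A i j.
Proof. by move=> H; apply: (continuous_cvg _ (@coord_continuous _ m p i j A) H). Qed.

Lemma cvg_rcons1 {T : Type} {F : set_system T} {FF : Filter F}
    (f : T -> R) (g : T -> 'rV[R]_n) t u :
  f @ F --> t -> g @ F --> u -> rcons1 (f x) (g x) @[x --> F] --> rcons1 t u.
Proof.
move=> ft gu; apply: cvg_mx => i j; rewrite (ord1 i).
case: (unliftP ord0 j) => [k|] ->.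
  rewrite rcons1_lift; under eq_fun do rewrite rcons1_lift; exact: cvg_coord.
by rewrite rcons1_0; under eq_fun do rewrite rcons1_0.
Qed.

Lemma rhead_continuous : continuous (@rhead R n).
Proof. exact: coord_continuous. Qed.

Lemma rtail_continuous : continuous (@rtail R n).
Proof.
move=> x; apply: (@cvg_mx _ (nbhs x) _) => i j; rewrite (ord1 i) rtailE.
under eq_fun do rewrite rtailE; exact: coord_continuous.
Qed.

End Rows.

(** * Chain rules for a change of the first coordinate *)

Section Chain.
Context {R : realType}.

Lemma is_derive_lineP (V W : normedModType R) (f : V -> W) (x v : V) df :
  is_derive (0 : R) 1 (fun s : R => f (s *: v + x)) df -> is_derive x v f df.
Proof.
have E : (fun h : R => h^-1 *: (f ((h *: (1 : R) + 0) *: v + x) - f (0 *: v + x)))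
   = (fun h => h^-1 *: (f (h *: v + x) - f x)).
  by apply/funext => h; rewrite addr0 [h *: 1]mulr1 scale0r add0r.
by move=> [D <-]; split; [move: D; rewrite /derivable /= E | rewrite /derive /= E].
Qed.

Lemma is_derive_comp1 (W : normedModType R) (w : R -> W) (g : R -> R) (t : R) dg dw :
  is_derive t 1 g dg -> is_derive (g t) 1 w dw ->
  is_derive t 1 (w \o g) (dg *: dw).
Proof.
move=> [/derivable1_diffP Dg Eg] [/derivable1_diffP Dw Ew].
split; first exact/derivable1_diffP/differentiable_comp.
rewrite deriveE; last exact: differentiable_comp.
rewrite diff_comp //= -Eg -Ew !deriveE//.
by rewrite -{1}['d g t 1]mulr1 linearZ.
Qed.

Context {a : nat}.

Definition reparam (phi : R -> R) (x : 'rV[R]_a.+1) : 'rV[R]_a.+1 :=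
  rcons1 (phi (rhead x)) (rtail x).

Lemma reparam_continuous phi : continuous phi -> continuous (reparam phi).
Proof.
move=> cphi x; apply: (@cvg_rcons1 _ _ _ (nbhs x)); last exact: rtail_continuous.
by apply: continuous_comp; [exact: rhead_continuous | exact: cphi].
Qed.

(** Along the first axis the composite is a curve [w] in [W] after a real function [g], so the
    one-variable chain rule applies and only the partial derivative of [h] in that direction
    enters. *)
Lemma is_derive_reparam0 (W : normedModType R) (h : 'rV[R]_a.+1 -> W) phi dphi x :
  is_derive (rhead x) 1 phi dphi ->
  derivable h (reparam phi x) (delta_mx 0 ord0) ->
  is_derive x (delta_mx 0 ord0) (h \o reparam phi)
    (dphi *: 'D_(delta_mx 0 ord0) h (reparam phi x)).
Proof.
move=> Dphi Dh; apply: is_derive_lineP.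
have E t : t *: delta_mx 0 ord0 + rcons1 0 (rtail x) = rcons1 t (rtail x).
  by rewrite delta_ord0 rcons1Z rcons1D mulr1 addr0 scaler0 add0r.
pose w (r : R) := h (r *: delta_mx 0 ord0 + rcons1 0 (rtail x)).
pose g (s : R) := phi (s *: 1 + rhead x).
have -> : (fun s => (h \o reparam phi) (s *: delta_mx 0 ord0 + x)) = w \o g.
  apply/funext => s; rewrite /w /g /= E /reparam; congr h.
  rewrite -{1 2}[x]rcons1_eta delta_ord0 rcons1Z rcons1D rcons1K rtail_rcons1.
  by rewrite scaler0 add0r.
have Dphi' : is_derive (0 : R) 1 g dphi.
  case: Dphi => D <-.
  have := @is_derive_line _ R R phi (rhead x) 1 0.
  by rewrite scale0r add0r; exact.
apply: is_derive_comp1 => //.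
have -> : reparam phi x = g 0 *: delta_mx 0 ord0 + rcons1 0 (rtail x).
  by rewrite E /g scale0r add0r.
apply: is_derive_line.
by rewrite E /g scale0r add0r.
Qed.

(** Along the other axes the first coordinate is constant, so [reparam phi] carries the line through
    [x] to the parallel line through [reparam phi x]. *)
Lemma is_derive_reparam_lift (W : normedModType R) (h : 'rV[R]_a.+1 -> W) phi i x :
  derivable h (reparam phi x) (delta_mx 0 (lift ord0 i)) ->
  is_derive x (delta_mx 0 (lift ord0 i)) (h \o reparam phi)
    ('D_(delta_mx 0 (lift ord0 i)) h (reparam phi x)).
Proof.
move=> Dh; apply: is_derive_lineP.
have -> : (fun s => (h \o reparam phi) (s *: delta_mx 0 (lift ord0 i) + x)) =
   (fun s : R => h (s *: delta_mx 0 (lift ord0 i) + reparam phi x)).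
  apply/funext => s /=; congr h; rewrite /reparam.
  rewrite -{1 2}[x]rcons1_eta delta_lift !rcons1Z !rcons1D rcons1K rtail_rcons1.
  by rewrite mulr0 !add0r.
have := @is_derive_line _ _ _ h (reparam phi x) (delta_mx 0 (lift ord0 i)) 0.
by rewrite scale0r add0r; exact.
Qed.

Lemma is_derive_slice (W : normedModType R) (h : 'rV[R]_a.+1 -> W) t i y :
  derivable h (rcons1 t y) (delta_mx 0 (lift ord0 i)) ->
  is_derive y (delta_mx 0 i) (fun y => h (rcons1 t y))
    ('D_(delta_mx 0 (lift ord0 i)) h (rcons1 t y)).
Proof.
move=> Dh; apply: is_derive_lineP.
have -> : (fun s : R => h (rcons1 t (s *: delta_mx 0 i + y))) =
   (fun s : R => h (s *: delta_mx 0 (lift ord0 i) + rcons1 t y)).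
  by apply/funext => s; rewrite delta_lift rcons1Z rcons1D mulr0 add0r.
have := @is_derive_line _ _ _ h (rcons1 t y) (delta_mx 0 (lift ord0 i)) 0.
by rewrite scale0r add0r; exact.
Qed.

End Chain.

(** * Smooth families of functions of one variable and a smooth step *)

Section SmoothFamilies.
Context {R : realType}.
Implicit Types (Z : topologicalType) (r : nat).

(** [Z] is just a topological space: derivatives are taken in the real variable only, and each of
    them has to be continuous in both arguments together. *)
Fixpoint Cfam Z r (c : Z -> R -> R) : Prop :=
  continuous (fun p : Z * R => c p.1 p.2) /\
  if r is r'.+1 then
    exists2 c' : Z -> R -> R,
      (forall z (t : R), is_derive t 1 (c z) (c' z t)) & Cfam r' c'
  else True.

Definition smooth_family Z (c : Z -> R -> R) := forall r, Cfam r c.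

Lemma Cfam_cont Z r (c : Z -> R -> R) :
  Cfam r c -> continuous (fun p : Z * R => c p.1 p.2).
Proof. by case: r => [|r] []. Qed.

Lemma Cfam_pred Z r (c : Z -> R -> R) : Cfam r.+1 c -> Cfam r c.
Proof.
elim: r c => [|r IH] c; first by case.
by move=> [cc [c' dc /IH Cc']]; split => //; exists c'.
Qed.

Lemma Cfam_param Z r (k : Z -> R) : continuous k -> Cfam r (fun z (_ : R) => k z).
Proof.
move=> ck.
have cp (k' : Z -> R) : continuous k' -> continuous (fun p : Z * R => k' p.1).
  move=> ck' p; apply: (@continuous_comp _ _ _ fst); first exact: cvg_fst.
  exact: ck'.
elim: r k ck => [|r IH] k ck; split => //; try exact: cp.
exists (fun _ _ => 0); first by move=> z t; exact: is_derive_cst.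
by apply: IH; exact: cst_continuous.
Qed.

Lemma Cfam_id Z r : Cfam r (fun (_ : Z) (t : R) => t).
Proof.
case: r => [|r]; split => //; try by move=> p; exact: cvg_snd.
exists (fun _ _ => 1); first by move=> z t; exact: is_derive_id.
by apply: Cfam_param; exact: cst_continuous.
Qed.

Lemma Cfam_add Z r (c d : Z -> R -> R) :
  Cfam r c -> Cfam r d -> Cfam r (fun z t => c z t + d z t).
Proof.
elim: r c d => [|r IH] c d Cc Cd; split => //;
  try by move=> p; apply: cvgD; [exact: (Cfam_cont Cc) | exact: (Cfam_cont Cd)].
case: Cc => _ [c' dc Cc]; case: Cd => _ [d' dd Cd].
by exists (fun z t => c' z t + d' z t); [move=> z t; exact: is_deriveD | exact: IH].
Qed.

Lemma Cfam_mul Z r (c d : Z -> R -> R) :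
  Cfam r c -> Cfam r d -> Cfam r (fun z t => c z t * d z t).
Proof.
elim: r c d => [|r IH] c d Cc Cd; split => //;
  try by move=> p; apply: cvgM; [exact: (Cfam_cont Cc) | exact: (Cfam_cont Cd)].
have [Cc1 Cd1] := (Cfam_pred Cc, Cfam_pred Cd).
case: Cc => _ [c' dc Cc]; case: Cd => _ [d' dd Cd].
exists (fun z t => c z t * d' z t + d z t * c' z t).
  by move=> z t; exact: is_deriveM.
by apply: Cfam_add; apply: IH.
Qed.

Lemma Cfam_opp Z r (c : Z -> R -> R) : Cfam r c -> Cfam r (fun z t => - c z t).
Proof.
move=> Cc; have -> : (fun z t => - c z t) = (fun z t => -1 * c z t).
  by apply/funext => z; apply/funext => t; rewrite mulN1r.
by apply: Cfam_mul => //; apply: Cfam_param; exact: cst_continuous.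
Qed.

Lemma Cfam_comp Z r (w g : Z -> R -> R) :
  Cfam r w -> Cfam r g -> Cfam r (fun z t => w z (g z t)).
Proof.
have C0 (w0 g0 : Z -> R -> R) r0 : Cfam r0 w0 -> Cfam r0 g0 ->
    continuous (fun p : Z * R => w0 p.1 (g0 p.1 p.2)).
  move=> /Cfam_cont cw /Cfam_cont cg p.
  exact: (@cvg_comp2 _ _ _ _ (nbhs p) (nbhs p.1) (nbhs (g0 p.1 p.2)) _ _ _ _
    fst (fun q => g0 q.1 q.2) w0 cvg_fst (cg p) (cw (p.1, _))).
elim: r w g => [|r IH] w g Cw Cg; split; try exact: C0 Cw Cg; first by [].
have [Cw1 Cg1] := (Cfam_pred Cw, Cfam_pred Cg).
case: Cw => _ [w' dw Cw]; case: Cg => _ [g' dg Cg].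
exists (fun z t => w' z (g z t) * g' z t).
  by move=> z t; exact: is_derive1_comp.
by apply: Cfam_mul => //; exact: IH.
Qed.

Lemma smooth_familyD Z (c d : Z -> R -> R) :
  smooth_family c -> smooth_family d -> smooth_family (fun z t => c z t + d z t).
Proof. by move=> Cc Cd r; apply: Cfam_add. Qed.

Lemma smooth_familyM Z (c d : Z -> R -> R) :
  smooth_family c -> smooth_family d -> smooth_family (fun z t => c z t * d z t).
Proof. by move=> Cc Cd r; apply: Cfam_mul. Qed.

Lemma smooth_family_param Z (k : Z -> R) :
  continuous k -> smooth_family (fun z (_ : R) => k z).
Proof. by move=> ck r; apply: Cfam_param. Qed.

Lemma smooth_family_cst Z (k : R) : smooth_family (fun (_ : Z) (_ : R) => k).
Proof. by apply: smooth_family_param; exact: cst_continuous. Qed.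

Lemma smooth_family_derive Z (c : Z -> R -> R) : smooth_family c ->
  (forall z (t : R), is_derive t 1 (c z) ((c z)^`()%classic t)) /\
  smooth_family (fun z t => (c z)^`()%classic t).
Proof.
move=> Cc; split=> [z t|r].
  case: (Cc 1%N) => _ [c' dc _]; rewrite derive1E.
  by apply/derivableP; case: (dc z t).
case: (Cc r.+1) => _ [c' dc Cc'].
rewrite (_ : (fun _ _ => _) = c')//; apply/funext => z; apply/funext => t.
by rewrite derive1E; apply: derive_val.
Qed.

End SmoothFamilies.

(** * A smooth step from 0 to 1 on [-1, 1] *)

Section SmoothStep.
Context {R : realType}.
Implicit Types t x : R.

(** For [n = 0] this is the usual flat function exp(-1/t). The powers of 1/t are included because
    differentiation then stays inside the family, up to linear combinations. *)
Definition flat n t : R := if 0 < t then t^-1 ^+ n * expR (- t^-1) else 0.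

Lemma flat_ge0 n t : 0 <= flat n t.
Proof.
rewrite /flat; case: ifP => // t0.
by rewrite mulr_ge0 ?expR_ge0// exprn_ge0// invr_ge0 ltW.
Qed.

(** For t > 0 one term of the exponential series gives exp(1/t) >= t^-(n+1) / (n+1)!. The linear
    bound yields the limit 0 at the origin. *)
Lemma flat_le n t : flat n t <= n.+1`!%:R * `|t|.
Proof.
rewrite /flat; case: ifPn => [t0|_]; last by rewrite mulr_ge0.
rewrite gtr0_norm// expRN ler_pdivrMr ?expR_gt0//.
have := @expR_ge1Dxn R t^-1 n; rewrite invr_ge0 ltW// => /(_ isT) H.
have f0 : 0 < n.+1`!%:R :> R by rewrite ltr0n fact_gt0.
have {}H : t^-1 ^+ n.+1 / n.+1`!%:R <= expR t^-1.
  by apply: le_trans H; rewrite lerDr.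
rewrite ler_pdivrMr// in H.
apply: le_trans (_ : t * t^-1 ^+ n.+1 <= _).
  by rewrite exprS mulrA divff ?gt_eqF// mul1r.
by rewrite [n.+1`!%:R * t]mulrC -mulrA ler_pM2l// mulrC.
Qed.

Lemma is_derive_flat n t : is_derive t 1 (flat n) (flat n.+2 t - n%:R * flat n.+1 t).
Proof.
have [t0|t0|->] := ltgtP t 0.
- rewrite /flat ltNge (ltW t0) /= mulr0 subrr.
  apply: (@near_eq_is_derive _ R R (cst 0)).
  by near=> y; rewrite ltNge ltW//; near: y; exact: lt_nbhsl.
- apply: (@near_eq_is_derive _ R R (fun t => t^-1 ^+ n * expR (- t^-1))).
    near=> y; rewrite /flat ifT//; near: y; exact: lt_nbhsr.
  rewrite /flat t0.
  have dV : is_derive t 1 (fun y : R => y^-1) (- t^-1 ^+ 2).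
    have := @is_deriveV _ id t 1 1; rewrite gt_eqF//= => /(_ isT (is_derive_id _ _)).
    by rewrite exprVn [_ *: 1]mulr1.
  have dX : is_derive t 1 (fun y : R => y^-1 ^+ n) (n%:R * t^-1 ^+ n.-1 * - t^-1 ^+ 2).
    have := is_deriveX n dV.
    by rewrite (_ : (fun y : R => y^-1) ^+ n = (fun y => y^-1 ^+ n))//; apply/funext => y; rewrite exprfctE.
  have dE : is_derive t 1 (fun y : R => expR (- y^-1)) (expR (- t^-1) * t^-1 ^+ 2).
    apply: (@is_derive1_comp _ expR (fun y => - y^-1)).
    rewrite -[t^-1 ^+ 2]opprK; exact: is_deriveN.
  refine (@is_derive_eq _ _ _ _ _ _ _ _ (is_deriveM dX dE) _).
  rewrite /GRing.scale /=.
  case: n {dX} => [|n] /=; first by rewrite !expr0; ring.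
  rewrite !exprS; ring.
- rewrite /flat ltxx mulr0 subrr -/(flat n).
  (* The difference quotient of [flat n] at 0 is exactly [flat n.+1], so its limit is given by
     [flat_le]. *)
  have E : (fun h : R => h^-1 *: (flat n (h *: (1 : R) + 0) - flat n 0)) = flat n.+1.
    apply/funext => h; rewrite addr0 [h *: 1]mulr1 /flat ltxx subr0.
    by case: ifP => h0; rewrite ?scaler0// exprS -mulrA.
  have L : flat n.+1 h @[h --> 0^'] --> (0 : R).
    apply/cvgrPdist_le => e e0; near=> h.
    rewrite sub0r normrN (ger0_norm (flat_ge0 _ _)) (le_trans (flat_le _ _))//.
    rewrite mulrC -ler_pdivlMr ?ltr0n ?fact_gt0//.
    near: h; apply: dnbhs0_le; by rewrite divr_gt0 ?ltr0n ?fact_gt0.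
  split; first by rewrite /derivable /= E; apply/cvg_ex; exists 0.
  by rewrite /derive /= E; exact: cvg_lim.
Unshelve. all: by end_near. Qed.

Lemma flat0_le t x : t <= x -> flat 0 t <= flat 0 x.
Proof.
move=> tx; rewrite {1}/flat; case: ifPn => t0; last exact: flat_ge0.
have x0 := lt_le_trans t0 tx.
by rewrite /flat x0 !expr0 !mul1r ler_expR lerN2 lef_pV2.
Qed.

Lemma Cfam_flat (Z : topologicalType) r n : Cfam r (fun _ : Z => flat n).
Proof.
have cc n0 : continuous (fun p : Z * R => flat n0 p.2).
  move=> p; apply: (@continuous_comp _ _ _ snd); first exact: cvg_snd.
  by apply/differentiable_continuous/derivable1_diffP; case: (is_derive_flat n0 p.2).
elim: r n => [|r IH] n; split; try exact: cc; first by [].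
exists (fun _ t => flat n.+2 t + - n%:R * flat n.+1 t).
  by move=> z t; rewrite mulNr; exact: is_derive_flat.
apply: Cfam_add => //; apply: Cfam_mul => //.
by apply: Cfam_param; exact: cst_continuous.
Qed.

(** [bend] is nonincreasing and vanishes from 1 on; [step] is [flat 0] of the drop of [bend] below
    its value at -1, normalized by a constant. Nesting [flat 0] in this way avoids integrals and
    variable denominators, so sums, products and composites of smooth families suffice. *)
Let bend t := flat 0 (1 - t).

Definition step t : R :=
  (flat 0 (bend (-1)))^-1 * flat 0 (bend (-1) - bend t).

Lemma smooth_step (Z : topologicalType) : smooth_family (fun _ : Z => step).
Proof.
move=> r; apply: Cfam_mul; first exact: smooth_family_cst.
apply: (Cfam_comp (g := fun _ t => bend (-1) - bend t) (Cfam_flat Z r 0)).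
apply: Cfam_add; first exact: smooth_family_cst.
apply: Cfam_opp; apply: (Cfam_comp (g := fun _ t => 1 - t) (Cfam_flat Z r 0)).
apply: Cfam_add; first exact: smooth_family_cst.
by apply: Cfam_opp; exact: Cfam_id.
Qed.

Lemma step_le t : t <= -1 -> step t = 0.
Proof.
move=> t1; rewrite /step [X in _ * X](_ : _ = 0) ?mulr0// /flat ifN//.
by rewrite -leNgt subr_le0 flat0_le// lerD2l lerN2.
Qed.

Lemma step_ge t : 1 <= t -> step t = 1.
Proof.
move=> t1; rewrite /step [bend t](_ : _ = 0) ?subr0.
  have b0 : 0 < bend (-1) by rewrite /bend /flat opprK ifT ?mulr_gt0 ?exprn_gt0 ?invr_gt0 ?expR_gt0 ?addr_gt0.
  by rewrite mulVf// /flat b0 expr0 mul1r gt_eqF// expR_gt0.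
by rewrite /bend /flat ifN// -leNgt subr_le0.
Qed.

End SmoothStep.

(** * Derivatives of reparametrized maps *)

Section Reparametrization.
Context {R : realType} {a b : nat} {Z : topologicalType}.
Variable phi : Z -> R -> R.
Hypothesis phiS : smooth_family phi.
Notation fn := ('rV[R]_a.+1 -> 'rV[R]_b).
Implicit Types (h : fn) (x : 'rV[R]_a.+1) (z : Z) (U : set 'rV[R]_a.+1).

(* The operators occurring as iterated partial derivatives of [h \o reparam]:
   enough of Faa di Bruno's formula to see joint continuity. *)
Inductive expands : (Z -> fn -> fn) -> Prop :=
| expands_term c s : smooth_family c ->
    expands (fun z h x => c z (rhead x) *: pder s h (reparam (phi z) x))
| expands_add T T' : expands T -> expands T' ->
    expands (fun z h x => T z h x + T' z h x).

(** The maps [hi] have to converge only through their jets at the moved points; this is the form in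
    which [jet_eval_cvg] supplies convergence. *)
Lemma expands_cvg T : expands T ->
  forall (I : Type) (F : set_system I) (FF : Filter F)
    (zi : I -> Z) (hi : I -> fn) (xi : I -> 'rV[R]_a.+1) z h x,
  zi @ F --> z -> xi @ F --> x ->
  (forall s, pder s (hi i) (reparam (phi (zi i)) (xi i)) @[i --> F] -->
             pder s h (reparam (phi z) x)) ->
  T (zi i) (hi i) (xi i) @[i --> F] --> T z h x.
Proof.
elim=> {T} [c s cS|T T' _ IH _ IH'] I F FF zi hi xi z h x Hz Hx H; last first.
  by apply: cvgD; [exact: IH | exact: IH'].
apply: cvgZ => //.
have /(_ (z, rhead x)) := Cfam_cont (cS 0%N).
apply: (@cvg_comp2 _ _ _ _ F (nbhs z) (nbhs (rhead x)) _ _ _ _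
  zi (fun i => rhead (xi i)) c) => //.
exact: (continuous_cvg _ (@rhead_continuous _ _ x) Hx).
Qed.

Lemma is_derive_rhead_comp (c : R -> R) dc x i :
  is_derive (rhead x) 1 c dc ->
  is_derive x (delta_mx 0 i) (fun y => c (rhead y))
    ((delta_mx 0 i : 'rV[R]_a.+1) 0 ord0 * dc).
Proof.
move=> Dc; apply: is_derive_lineP.
pose d : R := (delta_mx 0 i : 'rV[R]_a.+1) 0 ord0; rewrite -/d.
have -> : (fun s : R => c (rhead (s *: delta_mx 0 i + x))) = c \o (fun s => s * d + rhead x).
  by apply/funext => s; rewrite /rhead /d /= !mxE.
have Dg : is_derive (0 : R) 1 (fun s => s * d + rhead x) d.
  have := @is_derive_line _ R R id (rhead x) d 0.
  by rewrite derive_id; apply; exact: derivable_id.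
have := @is_derive_comp1 _ R c (fun s => s * d + rhead x) 0 d dc Dg.
by rewrite mul0r add0r; exact.
Qed.

Lemma is_deriveZ_fun (k : 'rV[R]_a.+1 -> R) h x v dk dh :
  is_derive x v k dk -> is_derive x v h dh ->
  is_derive x v (fun y => k y *: h y) (k x *: dh + dk *: h x).
Proof.
move=> Dk Dh; apply: is_derive_mx => i j.
have := is_deriveM Dk (is_derive_coord i j Dh).
rewrite (_ : (k * _)%R = (fun y => (k y *: h y) i j)); last first.
  by apply/funext => y; rewrite mxE.
by move=> D; apply: (is_derive_eq D); rewrite !mxE /GRing.scale /= [h x i j * _]mulrC.
Qed.

(** Leibniz and the chain rule on each term: the first direction replaces [c] by [c * phi'] on the
    next derivative and adds a term with [c'], while another direction only lengthens the word [s].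
    The operator [T'] is found before [z], [U], [h] and [x]. *)
Lemma expands_derive i T : expands T -> exists T', expands T' /\
  forall z U h x, open U -> Cinf_on U h -> U (reparam (phi z) x) ->
    is_derive x (delta_mx 0 i) (T z h) (T' z h x).
Proof.
elim=> {T} [c s cS|T T' _ [S [HS DS]] _ [S' [HS' DS']]]; last first.
  exists (fun z h x => S z h x + S' z h x); split; first exact: expands_add.
  by move=> z U h x oU Ch Ux; exact: (is_deriveD (DS z U h x oU Ch Ux) (DS' z U h x oU Ch Ux)).
have [dc c'S] := smooth_family_derive cS.
have [dphi phi'S] := smooth_family_derive phiS.
case: (unliftP ord0 i) => [j|] ->.
  exists (fun z h x => c z (rhead x) *: pder (lift ord0 j :: s) h (reparam (phi z) x)).
  split; first exact: expands_term.
  move=> z U h x oU Ch Ux.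
  have Dk := is_derive_rhead_comp (lift ord0 j) (dc z (rhead x)).
  have Dh := is_derive_reparam_lift ((Ch s _ Ux).2 (lift ord0 j)).
  have := is_deriveZ_fun Dk Dh.
  by move=> D; apply: (is_derive_eq D); rewrite mxE /= mul0r scale0r addr0.
exists (fun z h x => c z (rhead x) * (phi z)^`()%classic (rhead x) *:
    pder (ord0 :: s) h (reparam (phi z) x) +
  (c z)^`()%classic (rhead x) *: pder s h (reparam (phi z) x)).
split.
  apply: expands_add; last exact: (expands_term s c'S).
  exact: (expands_term (ord0 :: s) (smooth_familyM cS phi'S)).
move=> z U h x oU Ch Ux.
have Dk := is_derive_rhead_comp ord0 (dc z (rhead x)).
have Dh := is_derive_reparam0 (dphi z (rhead x)) ((Ch s _ Ux).2 ord0).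
have := is_deriveZ_fun Dk Dh.
by move=> D; apply: (is_derive_eq D); rewrite mxE /= mul1r scalerA.
Qed.

Let cphi z : continuous (phi z).
Proof.
move=> t; apply/differentiable_continuous/derivable1_diffP.
by case: ((smooth_family_derive phiS).1 z t).
Qed.

Lemma open_reparam z U : open U -> open (reparam (phi z) @^-1` U).
Proof. by move=> oU; apply: open_comp => // x _; exact: reparam_continuous. Qed.

(** A single [T] serves all [z], [h] and [x]. This uniformity allows passing to the limit in all
    three at once. *)
Lemma pder_reparam s : exists T, expands T /\
  forall z U h x, open U -> Cinf_on U h -> U (reparam (phi z) x) ->
    pder s (h \o reparam (phi z)) x = T z h x.
Proof.
elim: s => [|i s [T [HT ET]]].
  exists (fun z h x => 1 *: pder [::] h (reparam (phi z) x)); split.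
    by apply: (@expands_term (fun _ _ => 1) [::]); exact: smooth_family_cst.
  by move=> z U h x _ _ _; rewrite scale1r.
have [T' [HT' DT]] := expands_derive i HT; exists T'; split => // z U h x oU Ch Ux /=.
have [_ <-] := DT z U h x oU Ch Ux.
apply: near_eq_derive; near=> y; apply: ET Ch _ => //; near: y.
by apply: open_nbhs_nbhs; split => //; exact: open_reparam.
Unshelve. all: by end_near. Qed.

Lemma Cinf_on_reparam z U h : open U -> Cinf_on U h ->
  Cinf_on (reparam (phi z) @^-1` U) (h \o reparam (phi z)).
Proof.
move=> oU Ch s x Ux; have [T [HT ET]] := pder_reparam s.
have oV := @open_reparam z U oU.
have ETn : \forall y \near x, T z h y = pder s (h \o reparam (phi z)) y.
  near=> y; rewrite (ET z U h y)//; near: y; exact: open_nbhs_nbhs.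
split.
  have := near_eq_cvg ETn; move/(_ (nbhs_filter x)) => E.
  have K : T z h y @[y --> x] --> T z h x.
    have := @expands_cvg T HT _ (nbhs x) _ (fun _ => z) (fun _ => h) id z h x.
    apply; [exact: cvg_cst | exact: cvg_id |].
    move=> s'; apply: (@cvg_comp _ _ _ (reparam (phi z)) (pder s' h) (nbhs x)
      (nbhs (reparam (phi z) x))); last exact: (Ch s' _ Ux).1.
    exact: (reparam_continuous (@cphi z)).
  by rewrite /prop_for /continuous_at (ET z U)//; exact: cvg_trans E K.
move=> i; have [T' [_ DT]] := expands_derive i HT.
by apply: (near_eq_derivable ETn); case: (DT z U h x oU Ch Ux).
Unshelve. all: by end_near. Qed.

End Reparametrization.

(** * Derivatives of slices and of graphs *)

Section SliceGraph.
Context {R : realType} {a b : nat}.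
Implicit Types (h : 'rV[R]_a.+1 -> 'rV[R]_b).

Lemma open_slice (t : R) (U : set 'rV[R]_a.+1) : open U -> open (rcons1 t @^-1` U).
Proof.
move=> oU; apply: open_comp => // x _.
by apply: (@cvg_rcons1 _ _ _ (nbhs x)); [exact: cvg_cst | exact: cvg_id].
Qed.

Lemma pder_slice (U : set 'rV[R]_a.+1) h t s y :
  open U -> Cinf_on U h -> U (rcons1 t y) ->
  pder s (fun y => h (rcons1 t y)) y = pder (map (lift ord0) s) h (rcons1 t y).
Proof.
move=> oU Ch; elim: s y => [//|i s IH] y Uy /=.
have [_ <-] := is_derive_slice ((Ch (map (lift ord0) s) _ Uy).2 (lift ord0 i)).
apply: near_eq_derive; near=> y'; apply: IH; near: y'.
by apply: open_nbhs_nbhs; split => //; exact: open_slice.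
Unshelve. all: by end_near. Qed.

Lemma Cinf_on_slice (U : set 'rV[R]_a.+1) h t :
  open U -> Cinf_on U h -> Cinf_on (rcons1 t @^-1` U) (fun y => h (rcons1 t y)).
Proof.
move=> oU Ch s y Uy.
have oV := @open_slice t U oU.
have E : \forall y' \near y, pder (map (lift ord0) s) h (rcons1 t y') =
    pder s (fun y => h (rcons1 t y)) y'.
  near=> y'; rewrite (@pder_slice U)//; near: y'; exact: open_nbhs_nbhs.
have [ch dh] := Ch (map (lift ord0) s) _ Uy.
split.
  have := near_eq_cvg E; move/(_ (nbhs_filter y)) => E'.
  rewrite /prop_for /continuous_at (@pder_slice U)//; apply: cvg_trans E' _.
  apply: (@cvg_comp _ _ _ (rcons1 t) (pder (map (lift ord0) s) h) (nbhs y)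
    (nbhs (rcons1 t y))); last exact: ch.
  by apply: (@cvg_rcons1 _ _ _ (nbhs y)); [exact: cvg_cst | exact: cvg_id].
move=> i; apply: (near_eq_derivable E).
by case: (is_derive_slice (dh (lift ord0 i))).
Unshelve. all: by end_near. Qed.

(** The iterated partial derivatives of the first coordinate function in closed form: itself, a
    Kronecker delta, then 0. *)
Definition rhead_pder (s : seq 'I_a.+1) (x : 'rV[R]_a.+1) : R :=
  match s with
  | [::] => rhead x
  | [:: i] => (delta_mx 0 i : 'rV[R]_a.+1) 0 ord0
  | _ => 0
  end.

Lemma is_derive_rhead_pder s i x :
  is_derive x (delta_mx 0 i) (rhead_pder s) (rhead_pder (i :: s) x).
Proof.
case: s => [|j [|k s]] /=; try exact: is_derive_cst.
by have := is_derive_rhead_comp i (is_derive_id (rhead x) 1); rewrite mulr1.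
Qed.

Lemma rhead_pder_continuous s : continuous (rhead_pder s).
Proof.
by case: s => [|j [|k s]] /=; [exact: rhead_continuous|exact: cst_continuous..].
Qed.

Lemma is_derive_rcons1 (V : normedModType R) (p : V -> R) (q : V -> 'rV[R]_b) x v dp dq :
  is_derive x v p dp -> is_derive x v q dq ->
  is_derive x v (fun y => rcons1 (p y) (q y)) (rcons1 dp dq).
Proof.
move=> Dp Dq; apply: is_derive_mx => i j; rewrite (ord1 i).
case: (unliftP ord0 j) => [k|] ->.
  rewrite rcons1_lift; under eq_fun do rewrite rcons1_lift.
  exact: is_derive_coord.
by rewrite rcons1_0; under eq_fun do rewrite rcons1_0.
Qed.

Lemma pder_graph (U : set 'rV[R]_a.+1) h s x :
  open U -> Cinf_on U h -> U x ->
  pder s (fun y => rcons1 (rhead y) (h y)) x = rcons1 (rhead_pder s x) (pder s h x).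
Proof.
move=> oU Ch; elim: s x => [//|i s IH] x Ux /=.
have [_ D] := is_derive_rcons1 (is_derive_rhead_pder s i x)
  (derivableP ((Ch s x Ux).2 i)).
rewrite -D; apply: near_eq_derive; near=> y; apply: IH; near: y.
exact: open_nbhs_nbhs.
Unshelve. all: by end_near. Qed.

Lemma Cinf_on_graph (U : set 'rV[R]_a.+1) h :
  open U -> Cinf_on U h -> Cinf_on U (fun y => rcons1 (rhead y) (h y)).
Proof.
move=> oU Ch s x Ux.
have E : \forall y \near x, rcons1 (rhead_pder s y) (pder s h y) =
    pder s (fun y => rcons1 (rhead y) (h y)) y.
  near=> y; rewrite (@pder_graph U)//; near: y; exact: open_nbhs_nbhs.
split.
  have := near_eq_cvg E; move/(_ (nbhs_filter x)) => E'.
  rewrite /prop_for /continuous_at (@pder_graph U)//; apply: cvg_trans E' _.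
  apply: (@cvg_rcons1 _ _ _ (nbhs x)); first exact: rhead_pder_continuous.
  exact: (Ch s x Ux).1.
move=> i; apply: (near_eq_derivable E).
by case: (is_derive_rcons1 (is_derive_rhead_pder s i x)
  (derivableP ((Ch s x Ux).2 i))).
Unshelve. all: by end_near. Qed.

End SliceGraph.

(** * Jets of maps on sets with boundary *)

Section Jets.
Context {R : realType} {a b : nat}.
Implicit Types (D : set 'rV[R]_a) (f g : 'rV[R]_a -> 'rV[R]_b) (s : seq 'I_a).

(** The common property of open sets and of relatively open subsets of a half-space that makes the
    derivatives of an extension unique at boundary points. *)
Definition fat D := D `<=` closure (interior D).

Lemma fat_sub D D' : fat D -> D' `<=` D ->
  (forall x, D' x -> \forall y \near x, D y -> D' y) -> fat D'.
Proof.
move=> fD D'D H x D'x B Bx.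
pose V := interior ([set y | D y -> D' y] `&` B).
have Vx : V x by exact: filterI (H x D'x) Bx.
have oV : open V by exact: open_interior.
have VB := @interior_subset _ ([set y | D y -> D' y] `&` B).
have [y [Dy Vy]] := fD x (D'D _ D'x) V (open_nbhs_nbhs (conj oV Vx)).
exists y; split; last by case: (VB y Vy).
apply: filterS (filterI (open_nbhs_nbhs (conj oV Vy)) (nbhs_interior Dy)).
by move=> z [/VB[Dz _] /interior_subset /Dz].
Qed.

(** If the derivatives differed at [x], they would differ on a neighbourhood by continuity. That
    neighbourhood contains a point of the interior of [D], around which both extensions equal
    [f]. *)
Lemma local_extension_pder D f x g g' s : fat D -> D x ->
  local_extension D f x g -> local_extension D f x g' ->
  pder s g x = pder s g' x.
Proof.
move=> fD Dx [U [oU Ux Cg Eg]] [U' [oU' U'x Cg' Eg']].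
apply/eqP; rewrite -subr_eq0; apply/negPn/negP => neq.
have cd : pder s g y - pder s g' y @[y --> x] --> pder s g x - pder s g' x.
  by apply: (@cvgB _ _ _ (nbhs x)); [exact: (Cg s x Ux).1 | exact: (Cg' s x U'x).1].
have N : \forall y \near x, [/\ U y, U' y & pder s g y - pder s g' y != 0].
  near=> y; split; near: y; [exact: open_nbhs_nbhs|exact: open_nbhs_nbhs|].
  by apply: (cvgr_neq0 _ cd).
have [y [Dy [Uy U'y /eqP]]] := fD x Dx _ N; apply; apply/eqP.
rewrite subr_eq0; apply/eqP.
apply: (@pder_eq_open _ _ _ (interior D `&` (U `&` U'))) => //.
  by apply: openI; [exact: open_interior | exact: openI].
by move=> z [/interior_subset Dz [Uz U'z]]; rewrite Eg// Eg'.
Unshelve. all: by end_near. Qed.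

Definition jet D f s x := pder s (extension D f x) x.

Lemma extensionP D f x g :
  local_extension D f x g -> local_extension D f x (extension D f x).
Proof. by move=> H; apply: (@xgetPex _ f _); exists g. Qed.

Lemma jetE D f x g s : fat D -> D x -> local_extension D f x g ->
  jet D f s x = pder s g x.
Proof.
by move=> fD Dx H; apply: (local_extension_pder s fD Dx (extensionP H) H).
Qed.

(** The extension in [jet] is chosen anew at every point, so continuity is not immediate. One
    extension [g] at [x] serves all points of [D] nearby, and by [jetE] the jets there are the
    derivatives of this [g]. *)
Lemma jet_cvg D f x s : fat D -> smooth_on D f -> D x ->
  jet D f s y @[y --> within D (nbhs x)] --> jet D f s x.
Proof.
move=> fD fS Dx; have [g gx] := fS x Dx; rewrite (jetE _ fD Dx gx).
case: gx => U [oU Ux Cg Eg].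
have E : \forall y \near within D (nbhs x), pder s g y = jet D f s y.
  have : \forall y \near x, U y by exact: open_nbhs_nbhs.
  by apply: filterS => y Uy Dy; rewrite (jetE (g := g))//; exists U.
apply: cvg_trans (near_eq_cvg E) _.
by apply: cvg_within_filter; exact: (Cg s x Ux).1.
Qed.

End Jets.

Section FatModels.
Context {R : realType}.

Lemma fat_open n (O : set 'rV[R]_n) : open O -> fat O.
Proof.
by move=> oO x Ox; rewrite (interior_id _).1//; exact: subset_closure.
Qed.

Lemma fat_model n (D : set 'rV[R]_n) : model_open D -> fat D.
Proof.
move=> [ O oO [->|->]]; first exact: fat_open.
(* In dimension 0 there is no last coordinate and the half-space is everything. *)
case: n D O oO => [|n] _ O oO.
  rewrite (_ : O `&` halfspace R 0 = O); first exact: fat_open.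
  by rewrite eqEsubset; split=> [x []//|x Ox]; split => //; case.
move=> x [Ox Hx] B Bx.
(* A small positive move along the last axis enters the open half-space without leaving [O] or
   [B]. *)
have : \forall t \near (0 : R), (O `&` B) (x + t *: delta_mx 0 ord_max).
  have c : x + t *: delta_mx 0 ord_max @[t --> (0:R)] --> x.
    rewrite -{2}[x]addr0 -(scale0r (delta_mx 0 ord_max : 'rV[R]_n.+1)).
    by apply: cvgD; [exact: cvg_cst | apply: cvgZr_tmp; exact: cvg_id].
  by apply: c; apply: filterI => //; exact: open_nbhs_nbhs.
move=> /nbhs_ballP [e /= e0 eP].
have [|OB BB] := eP (e / 2).
  by rewrite /ball /= sub0r normrN ger0_norm ?divr_ge0 ?ltW// ltr_pdivrMr// ltr_pMr// ltr1n.
set y := x + _ in OB BB; exists y; split => //.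
have oP : open (O `&` [set z : 'rV[R]_n.+1 | 0 < z 0 ord_max]).
  apply: openI => //; apply: (@open_comp _ _ (fun z : 'rV[R]_n.+1 => z 0 ord_max) [set r | 0 < r]).
    by move=> z _; exact: coord_continuous.
  exact: open_gt.
apply: (@filterS _ (nbhs y) _ (O `&` [set z : 'rV[R]_n.+1 | 0 < z 0 ord_max])).
  move=> z [Oz z0]; split => // i [iE].
  by rewrite (_ : i = ord_max) ?ltW//; apply/val_inj.
apply: open_nbhs_nbhs; split => //; split => //=.
rewrite /y !mxE !eqxx mulr1 ltr_wpDl ?divr_gt0//.
exact: Hx.
Qed.

End FatModels.

(** * The weak topology through jets *)

Section Charts.
Context {R : realType} {X : topologicalType} {a : nat}.

(** The chart axioms in use below, with [fat] in place of [model_open]: fatness passes to products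
    with a line by [fat_rtail]. *)
Definition good_chart (c : chart R X a) :=
  [/\ open (cdom c), {within cdom c, continuous (cmap c)},
      {within cim c, continuous (cinv c)},
      {in cdom c, cancel (cmap c) (cinv c)} & fat (cim c)].

Definition small_compact_nbhds :=
  forall (x : X) N, nbhs x N -> exists K, [/\ compact K, nbhs x K & K `<=` N].

End Charts.
Arguments small_compact_nbhds : clear implicits.

Section WeakTopology.
Context {R : realType} {X Y : topologicalType} {a b : nat}.
Variables (A : atlas R X a) (B : atlas R Y b).
Local Notation W := (weakCinf A B).

Lemma weak_subbase_open (N : set W) : weak_subbase A B N -> open N.
Proof.
move=> HN; exists [set N]; last by rewrite bigcup_set1.
move=> _ ->; exists (fset1 N); last by rewrite set_fset1 bigcap_set1.
by move=> C; rewrite inE => /eqP ->; exact: mem_set.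
Qed.

Lemma cvg_weakCinf (I : Type) (F : set_system I) (FF : Filter F)
    (g : I -> W) (g0 : W) :
  (forall N, weak_subbase A B N -> N g0 -> F (g @^-1` N)) -> g @ F --> g0.
Proof.
move=> H N; rewrite /= nbhsE => -[ O [[C CD <-] [N1 CN1 N1g0]] ON].
have [S SD ES] := CD _ CN1.
have : F (g @^-1` N1).
  rewrite -ES preimage_bigcap; apply: filter_bigI => N' N'S.
  rewrite -ES in N1g0; apply: H; last exact: N1g0.
  exact/set_mem/(SD _ N'S).
by apply: filterS => x N1x; apply: ON; exists N1.
Qed.


Hypothesis goodA : forall c, A c -> good_chart c.
Hypothesis openB : forall d, B d -> open (cdom d).
Implicit Types (c : chart R X a) (d : chart R Y b) (f g : X -> Y).

Lemma good_cancel c x : good_chart c -> cdom c x -> cinv c (cmap c x) = x.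
Proof. by move=> [_ _ _ ci _] cx; apply: ci; exact: mem_set. Qed.

Lemma rep_domE c d f x : good_chart c -> cdom c x ->
  rep_dom c d f (cmap c x) <-> cdom d (f x).
Proof.
move=> gc cx; rewrite /rep_dom /= (good_cancel gc)//; split=> [[]//|dx].
by split => //; exists x.
Qed.

Lemma cinv_cvg c y : good_chart c -> cim c y ->
  cinv c z @[z --> within (cim c) (nbhs y)] --> cinv c y.
Proof. by move=> [_ _ /subspace_continuousP H _ _]; exact: H. Qed.

Lemma cmap_cvg c x : good_chart c -> cdom c x -> cmap c z @[z --> x] --> cmap c x.
Proof.
move=> [oc /subspace_continuousP H _ _ _] cx.
have := H x cx; rewrite within_interior//.
by rewrite (interior_id _).1.
Qed.

Lemma rep_dom_rel c d f x : good_chart c -> open (cdom d) -> continuous f ->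
  rep_dom c d f x -> \forall y \near x, cim c y -> rep_dom c d f y.
Proof.
move=> gc od cf [ix dx].
have := @cvg_comp _ _ _ _ _ _ _ _ (cinv_cvg gc ix) (cf (cinv c x)).
move=> /(_ (cdom d)); rewrite /= /nbhs /= => H.
have := H (open_nbhs_nbhs (conj od dx)); rewrite /within /nbhs /=.
by apply: filterS => y Hy cy; split => //; exact: Hy.
Qed.

Lemma fat_rep_dom c d f : good_chart c -> open (cdom d) -> continuous f ->
  fat (rep_dom c d f).
Proof.
move=> gc od cf; have [_ _ _ _ fc] := gc; apply: (fat_sub fc); first by move=> x [].
by move=> x; exact: rep_dom_rel.
Qed.

(** The inequalities in [weak_subbasic] are, by conversion, inequalities between these values. *)
Definition chart_jet c d f s (x : X) := jet (rep_dom c d f) (rep c d f) s (cmap c x).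

Lemma chart_jet_cvg c d f s x : A c -> B d -> smooth A B f -> cdom c x ->
  cdom d (f x) -> chart_jet c d f s y @[y --> x] --> chart_jet c d f s x.
Proof.
move=> Ac Bd [cf sf] cx dx; have gc := goodA Ac; have od := openB Bd.
have Dx : rep_dom c d f (cmap c x) by apply/rep_domE.
have := jet_cvg (s := s) (fat_rep_dom gc od cf) (sf c d Ac Bd) Dx.
apply: (@cvg_comp _ _ _ (cmap c) (jet (rep_dom c d f) (rep c d f) s) (nbhs x)).
move=> N; rewrite /within /nbhs /= => NN.
have [oc _ _ _ _] := gc.
have cdx : \forall y \near x, cdom c y by exact: open_nbhs_nbhs.
have ddx : \forall y \near x, cdom d (f y) by apply: cf; exact: open_nbhs_nbhs.
have := cmap_cvg gc cx NN; rewrite /nbhs /=.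
apply: filterS3 cdx ddx => y cy dy; apply.
exact/rep_domE.
Qed.

(** A compact neighbourhood [K] of [x] inside the chart is a legitimate test set, so maps close to
    [f0] have jets close to those of [f0] uniformly on [K]; the jets of [f0] itself are continuous
    at [x]. *)
Lemma jet_eval_cvg c d (f0 : W) s x : small_compact_nbhds X ->
  A c -> B d -> smooth A B f0 -> cdom c x -> cdom d (f0 x) ->
  (\forall f \near f0 & y \near x, cdom d ((f : W) y)) /\
  chart_jet c d p.1 s p.2 @[p --> (f0, x)] --> chart_jet c d f0 s x.
Proof.
move=> lcX Ac Bd sf cx dx.
have [oc _ _ _ _] := goodA Ac; have od := openB Bd; have [cf _] := sf.
have cdx : \forall y \near x, cdom c y /\ cdom d (f0 y).
  apply: filterI; first exact: open_nbhs_nbhs.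
  by apply: cf; exact: open_nbhs_nbhs.
have [K [cK Kx KN]] := lcX x _ cdx.
have N (e : R) : 0 < e -> \forall f \near f0, weak_subbasic f0 c d K (size s) e f.
  move=> e0; apply: open_nbhs_nbhs; split.
    apply: weak_subbase_open; exists f0, c, d, K, (size s), e; split; split => //.
    - by move=> y /KN[].
    - by move=> _ [y /KN[_ ?] <-].
  by move=> y /KN[_ dy]; split => // s' _; rewrite subrr normr0.
split.
  (* Any radius would do: only the domain condition of [weak_subbasic] is extracted here. *)
  by near=> f y; have [] := near (N 1 ltr01) f _ y (near Kx y _).
apply/cvgrPdist_lt => e e0.
have e2 : 0 < e / 2 by rewrite divr_gt0.
have J : \forall y \near x, `|chart_jet c d f0 s x - chart_jet c d f0 s y| < e / 2.
  exact: (cvgr_dist_lt _ _ (chart_jet_cvg (s := s) Ac Bd sf cx dx) _ e2).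
near=> p.
have Wp : weak_subbasic f0 c d K (size s) (e / 2) p.1.
  by near: p; apply: (cvg_fst (N _ e2)).
have Kp : K p.2 by near: p; apply: (cvg_snd Kx).
have [_ /(_ s (leqnn _)) H1] := Wp _ Kp.
have H2 : `|chart_jet c d f0 s x - chart_jet c d f0 s p.2| < e / 2.
  by near: p; apply: (cvg_snd J).
have -> : chart_jet c d f0 s x - chart_jet c d p.1 s p.2 =
    (chart_jet c d f0 s x - chart_jet c d f0 s p.2) -
    (chart_jet c d p.1 s p.2 - chart_jet c d f0 s p.2) by rewrite opprB addrA subrK.
rewrite (splitr e); apply: le_lt_trans (ler_normB _ _) _; exact: ltrD.
Unshelve. all: by end_near. Qed.

(** Joint convergence in the point and the index gives the required inequality near each point of
    [K], and compactness makes it uniform. A sub-basic set containing [g0] may be centred at another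
    map [f], hence the comparison with the jets of [f], which are continuous too. *)
Lemma cvg_weakCinf_jets (I : Type) (F : set_system I) (FF : Filter F)
    (g : I -> W) (g0 : W) : smooth A B g0 ->
  (forall c d x, A c -> B d -> cdom c x -> cdom d (g0 x) ->
    (\forall y \near x & i \near F, cdom d (g i y)) /\
    forall s, chart_jet c d (g p.2) s p.1 @[p --> (nbhs x, F)] -->
      chart_jet c d g0 s x) ->
  g @ F --> g0.
Proof.
move=> sg0 H; apply: cvg_weakCinf => N [f [c [d [K [r [e [[sf Ac Bd e0]]]]]]]].
move=> [cK Kc fK ->] g0N.
have HK : \forall i \near F, K `<=` [set x | cdom d (g i x) /\
    forall s : seq 'I_a, (size s <= r)%N ->
      `|chart_jet c d (g i) s x - chart_jet c d f s x| < e].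
  move/compact_near_coveringP : cK; apply => x Kx.
  have cx := Kc _ Kx.
  have dfx : cdom d (f x) by apply: fK; exists x.
  have [dx Hs] := g0N _ Kx; have [Hd Hj] := H c d x Ac Bd cx dx.
  apply: filterI; first exact: Hd.
  (* Words of length at most [r] form a finite type, so the finitely many conditions can be
     intersected. *)
  have : \forall p \near (nbhs x, F), forall s : r.-bseq 'I_a,
      `|chart_jet c d (g p.2) s p.1 - chart_jet c d f s p.1| < e.
    apply: (@filter_forall _ _ _ (filter_prod (nbhs x) F)) => s.
    have L : chart_jet c d (g p.2) s p.1 - chart_jet c d f s p.1
        @[p --> (nbhs x, F)] --> chart_jet c d g0 s x - chart_jet c d f s x.
      apply: (@cvgB _ _ _ (filter_prod (nbhs x) F)); first exact: Hj.
      apply: (@cvg_comp _ _ _ fst (chart_jet c d f s) _ (nbhs x)); first exact: cvg_fst.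
      exact: chart_jet_cvg.
    apply: (cvgr_norm_lt _ L).
    by apply: (Hs s); exact: size_bseq.
  by apply: filterS => p Hp s sr; have := Hp (Bseq sr).
by apply: filterS HK => i Hi x Kx; have [] := Hi _ Kx.
Qed.

End WeakTopology.

(** * Suspensions of atlases and graphs of loops *)

Section Suspension.
Context {R : realType} {X X' : topologicalType} {a : nat}.

(* [X'] is [R * X] up to a homeomorphism matching the charts; this covers both
   R^(j+1) over R^j and R^(j+1) * M over R^j * M. *)
Record suspension (A : atlas R X a) (A' : atlas R X' a.+1)
    (h : X' -> R * X) (k : R * X -> X') : Prop := Suspension {
  susp_h : continuous h;
  susp_k : continuous k;
  susp_hK : cancel h k;
  susp_kK : cancel k h;
  susp_chart : forall c', A' c' -> exists2 c, A c &
    [/\ forall x', cdom c' x' <-> cdom c (h x').2,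
        forall x', cmap c' x' = rcons1 (h x').1 (cmap c (h x').2) &
        forall v, cinv c' v = k (rhead v, cinv c (rtail v))]
}.

Lemma fat_rtail (D : set 'rV[R]_a) : fat D -> fat ((@rtail R a) @^-1` D).
Proof.
move=> fD x Dx B Bx.
have c : rcons1 (rhead x) u @[u --> rtail x] --> x.
  rewrite -{3}[x]rcons1_eta.
  by apply: (@cvg_rcons1 _ _ _ (nbhs (rtail x))); [exact: cvg_cst | exact: cvg_id].
have [u [Du Bu]] := fD _ Dx _ (c _ Bx).
exists (rcons1 (rhead x) u); split => //.
apply: (@filterS _ (nbhs (rcons1 (rhead x) u)) _ ((@rtail R a) @^-1` interior D)).
  by move=> y /interior_subset.
by apply: rtail_continuous; rewrite rtail_rcons1; exact: nbhs_interior.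
Qed.

Lemma good_suspension (A : atlas R X a) (A' : atlas R X' a.+1) h k :
  suspension A A' h k -> (forall c, A c -> good_chart c) ->
  forall c', A' c' -> good_chart c'.
Proof.
move=> [ch ck hK kK chart] gA c' /chart[c Ac [dE mE iE]].
have gc := gA c Ac; have [oc cc ic ci fc] := gc.
have imE v : cim c' v <-> cim c (rtail v).
  split=> [[x' dx <-]|[x dx E]].
    by rewrite mE rtail_rcons1; exists (h x').2 => //; apply/dE.
  exists (k (rhead v, x)); first by apply/dE; rewrite kK.
  by rewrite mE kK /= E rcons1_eta.
have c2 : continuous (fun x' => (h x').2).
  by move=> x'; apply: (cvg_comp _ _ (ch x')); exact: cvg_snd.
have dE' : cdom c' = (fun x' => (h x').2) @^-1` cdom c.
  by apply/seteqP; split=> x' /dE.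
have oc' : open (cdom c') by rewrite dE'; apply: open_comp => // x' _; exact: c2.
split => //.
- apply/subspace_continuousP => x' cx'.
  rewrite within_interior; last by rewrite (interior_id _).1.
  rewrite /from_subspace (funext mE).
  apply: (@cvg_rcons1 _ _ _ (nbhs x')).
    by apply: (cvg_comp _ _ (ch x')); exact: cvg_fst.
  apply: (@cvg_comp _ _ _ (fun y => (h y).2) (cmap c) (nbhs x') (nbhs (h x').2)); first exact: c2.
  by apply: cmap_cvg => //; exact/dE.
- apply/subspace_continuousP => v cv.
  rewrite /from_subspace (funext iE).
  apply: (@cvg_comp _ _ _ (fun y => (rhead y, cinv c (rtail y))) k
     (within (cim c') (nbhs v)) (nbhs (rhead v, cinv c (rtail v)))); last exact: ck.
  apply: (@cvg_pair _ _ _ (within (cim c') (nbhs v)) (nbhs (rhead v)) (nbhs (cinv c (rtail v)))).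
    by apply: (@cvg_within_filter _ _ _ (nbhs v)); exact: rhead_continuous.
  apply: (@cvg_comp _ _ _ (@rtail R a) (cinv c) (within (cim c') (nbhs v))
     (within (cim c) (nbhs (rtail v)))); last by apply: cinv_cvg => //; exact/imE.
  move=> N NN.
  have NN' : \forall y \near v, cim c (rtail y) -> N (rtail y).
    exact: (@rtail_continuous _ _ v _ NN).
  by apply: filterS NN' => y Hy /imE; exact: Hy.
- move=> x' /set_mem/dE cx'.
  by rewrite mE iE rcons1K rtail_rcons1 (good_cancel gc)// -surjective_pairing hK.
- rewrite (_ : cim c' = (@rtail R a) @^-1` cim c); first exact: fat_rtail.
  by apply/seteqP; split=> v /imE.
Qed.

End Suspension.

(** R x X is its own suspension; through [good_suspension] its charts inherit the properties of
    those of X. *)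
Lemma suspension_id (R : realType) (X : topologicalType) (a : nat) (A : atlas R X a) :
  suspension A (prod_atlas (real_line R) A) id id.
Proof.
split => //; try by move=> x; exact: cvg_id.
move=> _ [_ -> [c Ac <-]]; exists c => //; split => [p|p|v] /=.
- by split=> [[]|].
- by [].
- congr (_, _); rewrite /rhead mxE; congr (v _ _); exact/val_inj.
Qed.

Lemma Cinf_diff (R : realType) a b (U : set 'rV[R]_a) (g : 'rV[R]_a -> 'rV[R]_b) x :
  open U -> Cinf_on U g -> U x ->
  forall v, 'd g x v = \sum_i v 0 i *: pder [:: i] g x.
Proof.
move=> oU Cg Ux; apply: (C1_differentiable _ _).2; last first.
  by move=> i; exact: (Cg [:: i] x Ux).1.
have : \forall y \near x, U y by exact: open_nbhs_nbhs.
by apply: filterS => y Uy i; exact: (Cg [::] y Uy).2.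
Qed.

(** * Charts of R x X and restriction to slices *)

Section LineChart.
Context {R : realType} {X : topologicalType} {a : nat}.

Definition line_chart (c : chart R X a) : chart R (R * X)%type a.+1 :=
  prod_chart (Chart setT (fun t : R => t%:M) (fun v : 'rV[R]_1 => v 0 0)) c.

Lemma line_chart_in (A : atlas R X a) c : A c ->
  prod_atlas (real_line R) A (line_chart c).
Proof. by move=> Ac; eexists; [reflexivity|exists c]. Qed.

Lemma cinv_line_chart c v : cinv (line_chart c) v = (rhead v, cinv c (rtail v)).
Proof. by rewrite /=; congr (_, _); rewrite /rhead mxE; congr (v _ _); exact/val_inj. Qed.

Lemma cim_line_chart c v : cim (line_chart c) v <-> cim c (rtail v).
Proof.
split=> [[[t x] [_ dx] <-]|[x dx E]].
  by exists x => //; symmetry; exact: (rtail_rcons1 t (cmap c x)).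
exists (rhead v, x) => //; rewrite -[RHS]rcons1_eta -E; exact: erefl.
Qed.

Lemma rep_slice {Y : topologicalType} {b : nat} (c : chart R X a) (d : chart R Y b)
    (l : R * X -> Y) t y :
  rep c d (fun x => l (t, x)) y = rep (line_chart c) d l (rcons1 t y).
Proof. by rewrite /rep cinv_line_chart rcons1K rtail_rcons1. Qed.

Lemma rep_dom_slice {Y : topologicalType} {b : nat} (c : chart R X a) (d : chart R Y b)
    (l : R * X -> Y) t y :
  rep_dom c d (fun x => l (t, x)) y <-> rep_dom (line_chart c) d l (rcons1 t y).
Proof.
have E : cdom d (l (t, cinv c y)) <-> cdom d (l (cinv (line_chart c) (rcons1 t y))).
  by rewrite cinv_line_chart rcons1K rtail_rcons1.
have I := cim_line_chart c (rcons1 t y); rewrite rtail_rcons1 in I.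
by split=> [[? /E ?]|[/I ? /E ?]]; split => //; exact/I.
Qed.

Lemma local_extension_slice {Y : topologicalType} {b : nat} (c : chart R X a)
    (d : chart R Y b) (l : R * X -> Y) t y g :
  local_extension (rep_dom (line_chart c) d l) (rep (line_chart c) d l)
    (rcons1 t y) g ->
  local_extension (rep_dom c d (fun x => l (t, x))) (rep c d (fun x => l (t, x))) y
    (fun y => g (rcons1 t y)).
Proof.
move=> [U [oU Uy Cg Eg]]; exists (rcons1 t @^-1` U); split => //.
- exact: open_slice.
- exact: Cinf_on_slice.
- by move=> z Uz /rep_dom_slice Dz; rewrite Eg// rep_slice.
Qed.

Lemma slice_continuous {Y : topologicalType} (l : R * X -> Y) t :
  continuous l -> continuous (fun x => l (t, x)).
Proof.
move=> cl x; apply: (@cvg_comp _ _ _ (fun x => (t, x)) l (nbhs x) (nbhs (t, x))); last exact: cl.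
by apply: (@cvg_pair _ _ _ (nbhs x) (nbhs t)); [exact: cvg_cst | exact: cvg_id].
Qed.

End LineChart.

(** * Smoothness, continuity and immersivity of graphs of loops *)

Section Graph.
Context {R : realType} {X Y X' Y' : topologicalType} {a b : nat}.
Variables (A : atlas R X a) (B : atlas R Y b) (A' : atlas R X' a.+1) (B' : atlas R Y' b.+1).
Variables (hX : X' -> R * X) (kX : R * X -> X') (hY : Y' -> R * Y) (kY : R * Y -> Y').
Hypotheses (sX : suspension A A' hX kX) (sY : suspension B B' hY kY).
Hypotheses (goodA : forall c, A c -> good_chart c)
  (openB : forall d, B d -> open (cdom d)).
Local Notation RA := (prod_atlas (real_line R) A).

(** One formula for all maps of the proof: [phi] the identity gives gr_1, and the reparametrizations
    [ramp z] give the lifted path. *)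
Definition graph_map (phi : R -> R) (l : R * X -> Y) (x' : X') : Y' :=
  kY ((hX x').1, l (phi (hX x').1, (hX x').2)).

Let goodRA c : RA c -> good_chart c.
Proof. exact: good_suspension (suspension_id A) goodA c. Qed.

Let goodA' c : A' c -> good_chart c.
Proof. exact: good_suspension sX goodA c. Qed.

Let openB' d : B' d -> open (cdom d).
Proof.
move=> /(susp_chart sY)[d0 /openB od0 [dE _ _]].
rewrite (_ : cdom d = (fun y => (hY y).2) @^-1` cdom d0); last first.
  by apply/seteqP; split=> y /dE.
apply: open_comp => // y _.
by apply: (cvg_comp _ _ (susp_h sY (x:=y))); exact: cvg_snd.
Qed.

(** Charts of the suspensions lie over charts of X and Y. In them a graph takes the form
    [rcons1 (rhead v) (h (reparam phi v))], with [h] representing [l], to which the calculus of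
    reparametrizations applies. *)
Definition matching_charts c' d' c d :=
  [/\ A c, B d,
      forall x', cdom c' x' -> cdom c (hX x').2 /\
        cmap c' x' = rcons1 (hX x').1 (cmap c (hX x').2),
      forall y', cdom d' y' <-> cdom d (hY y').2 &
      forall phi l v,
        rep c' d' (graph_map phi l) v =
          rcons1 (rhead v) (rep (line_chart c) d l (reparam phi v)) /\
        (rep_dom c' d' (graph_map phi l) v <->
         rep_dom (line_chart c) d l (reparam phi v))].

Lemma matching_chartsP c' d' : A' c' -> B' d' ->
  exists c d, matching_charts c' d' c d.
Proof.
move=> A'c' B'd'.
have [c Ac [cE cmE ciE]] := susp_chart sX A'c'.
have [d Bd [dE dmE diE]] := susp_chart sY B'd'.
exists c, d; split => //; first by move=> x' /cE.
move=> phi l v.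
have kKX := susp_kK sX; have kKY := susp_kK sY.
split.
  by rewrite /rep cinv_line_chart ciE dmE /graph_map kKY kKX /= rcons1K rtail_rcons1.
have E1 : cim c' v <-> cim c (rtail v).
  split=> [[x' /cE dx <-]|[x dx E]].
    by rewrite cmE rtail_rcons1; exists (hX x').2.
  exists (kX (rhead v, x)); first by apply/cE; rewrite kKX.
  by rewrite cmE kKX /= E rcons1_eta.
have E2 := cim_line_chart c (reparam phi v).
rewrite rtail_rcons1 in E2.
have E3 : cdom d' (graph_map phi l (cinv c' v)) <->
    cdom d (l (cinv (line_chart c) (reparam phi v))).
  by rewrite dE cinv_line_chart rcons1K rtail_rcons1 ciE /graph_map kKY kKX.
by split=> [[/E1 ? /E3 ?]|[/E2 ? /E3 ?]]; split => //; [exact/E2 | exact/E1].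
Qed.

Lemma graph_continuous phi l : continuous phi -> continuous l ->
  continuous (graph_map phi l).
Proof.
move=> cphi cl x'; apply: (@cvg_comp _ _ _ _ kY _ (nbhs ((hX x').1, l (phi (hX x').1, (hX x').2)))); last exact: (susp_k sY).
have c1 : (hX y).1 @[y --> x'] --> (hX x').1.
  by apply: (cvg_comp _ _ (susp_h sX (x:=x'))); exact: cvg_fst.
have c2 : (hX y).2 @[y --> x'] --> (hX x').2.
  by apply: (cvg_comp _ _ (susp_h sX (x:=x'))); exact: cvg_snd.
apply: (@cvg_pair _ _ _ (nbhs x') (nbhs (hX x').1)) => //.
apply: (@cvg_comp _ _ _ (fun y => (phi (hX y).1, (hX y).2)) l (nbhs x') (nbhs (phi (hX x').1, (hX x').2))); last exact: cl.
apply: (@cvg_pair _ _ _ (nbhs x') (nbhs (phi (hX x').1))) => //.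
by apply: (cvg_comp _ _ c1); exact: cphi.
Qed.

Section Family.
Context {Z : topologicalType}.
Variable phi : Z -> R -> R.
Hypothesis phiS : smooth_family phi.

Lemma smooth_family_continuous z : continuous (phi z).
Proof.
move=> t; apply/differentiable_continuous/derivable1_diffP.
by case: ((smooth_family_derive phiS).1 z t).
Qed.

Lemma local_extension_graph z c' d' c d l v g :
  matching_charts c' d' c d ->
  local_extension (rep_dom (line_chart c) d l) (rep (line_chart c) d l)
    (reparam (phi z) v) g ->
  local_extension (rep_dom c' d' (graph_map (phi z) l))
    (rep c' d' (graph_map (phi z) l)) v
    (fun w => rcons1 (rhead w) ((g \o reparam (phi z)) w)).
Proof.
move=> [_ _ _ _ mE] [U [oU Uv Cg Eg]].
have oV := @open_reparam _ _ _ _ phiS z U oU.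
exists (reparam (phi z) @^-1` U); split => //.
  by apply: Cinf_on_graph => //; exact: Cinf_on_reparam.
move=> w Uw; have [-> ->] := mE (phi z) l w.
by move=> Dw /=; rewrite Eg.
Qed.

Lemma smooth_graph z l : smooth RA B l -> smooth A' B' (graph_map (phi z) l).
Proof.
move=> [cl sl]; split.
  by apply: graph_continuous => //; exact: smooth_family_continuous.
move=> c' d' A'c' B'd' v Dv.
have [c [d M]] := matching_chartsP A'c' B'd'.
have [Ac Bd _ _ mE] := M.
have [g gP] := sl (line_chart c) d (line_chart_in Ac) Bd _ ((mE (phi z) l v).2.1 Dv).
by eexists; exact: local_extension_graph M gP.
Qed.

(** The operator [T] depends on the word [s] only, not on the charts, the parameter, the loop or the
    point; the extension of the loop is the chosen one at the moved point. *)
Lemma chart_jet_graph s : exists T, expands phi T /\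
  forall z l c' d' c d x', matching_charts c' d' c d -> A' c' -> B' d' ->
    smooth RA B l -> cdom c' x' -> cdom d' (graph_map (phi z) l x') ->
    chart_jet c' d' (graph_map (phi z) l) s x' =
    rcons1 (rhead_pder s (cmap c' x'))
      (T z (extension (rep_dom (line_chart c) d l) (rep (line_chart c) d l)
             (reparam (phi z) (cmap c' x'))) (cmap c' x')).
Proof.
have [T [HT ET]] := pder_reparam (b := b) phiS s; exists T; split => //.
move=> z l c' d' c d x' M A'c' B'd' sl cx dx.
have [Ac Bd _ _ mE] := M; set v := cmap c' x'.
have Dv : rep_dom c' d' (graph_map (phi z) l) v by apply/rep_domE => //; exact: goodA'.
have [g0 g0P] := sl.2 _ d (line_chart_in Ac) Bd _ ((mE (phi z) l v).2.1 Dv).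
have gP := extensionP g0P; set g := extension _ _ _ in gP *.
have GP := local_extension_graph M gP.
have cG := (smooth_graph z sl).1.
rewrite /chart_jet -/v (jetE s (fat_rep_dom (goodA' A'c') (openB' B'd') cG) Dv GP).
have [U [oU Uv Cg _]] := gP.
have oV := @open_reparam _ _ _ _ phiS z U oU.
rewrite (pder_graph s oV) //; last exact: Cinf_on_reparam.
by rewrite (ET z U).
Qed.

(** The joint continuity on which all homotopies rest. Jets of graphs are [expands] operators on
    jets of the loops, and the latter converge by joint continuity of evaluation on R x X. *)
Lemma graph_cvg (I : Type) (F : set_system I) (FF : Filter F) (zi : I -> Z)
    (li : I -> weakCinf RA B) z (l : weakCinf RA B) :
  small_compact_nbhds (R * X)%type ->
  zi @ F --> z -> li @ F --> l -> (\forall i \near F, smooth RA B (li i)) ->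
  smooth RA B l ->
  (graph_map (phi (zi i)) (li i) : weakCinf A' B') @[i --> F] -->
    (graph_map (phi z) l : weakCinf A' B').
Proof.
move=> lc Hz Hl sli sl.
apply: (cvg_weakCinf_jets goodA') => //; first exact: smooth_graph.
move=> c' d' x' A'c' B'd' cx dx.
have [c [d M]] := matching_chartsP A'c' B'd'.
have [Ac Bd cE dE mE] := M.
have [cx2 vE] := cE _ cx.
pose G := filter_prod (nbhs x') F.
have FG : Filter G by exact: filter_prod_filter.
(* The point of R x X at which the loop is evaluated; it moves with both [z] and [x']. *)
pose q (z : Z) (x' : X') : R * X := (phi z (hX x').1, (hX x').2).
have phic : continuous (fun p : Z * R => phi p.1 p.2) := Cfam_cont (phiS 0%N).
have hc : hX p.1 @[p --> G] --> hX x'.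
  by apply: (@cvg_comp _ _ _ fst hX G (nbhs x')); [exact: cvg_fst | exact: (susp_h sX)].
have h1 : (hX p.1).1 @[p --> G] --> (hX x').1.
  by apply: (cvg_comp _ _ hc); exact: cvg_fst.
have h2 : (hX p.1).2 @[p --> G] --> (hX x').2.
  by apply: (cvg_comp _ _ hc); exact: cvg_snd.
have zc : zi p.2 @[p --> G] --> z.
  by apply: (@cvg_comp _ _ _ snd zi G F) => //; exact: cvg_snd.
have qc : q (zi p.2) p.1 @[p --> G] --> q z x'.
  rewrite /q; apply: (@cvg_pair _ _ _ G (nbhs (phi z (hX x').1)) (nbhs (hX x').2)) => //.
  exact: (@cvg_comp2 _ _ _ _ G (nbhs z) (nbhs (hX x').1) _ _ _ _
    (fun p => zi p.2) (fun p => (hX p.1).1) phi zc h1 (phic (z, _))).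
have lqc : (li p.2, q (zi p.2) p.1) @[p --> G] --> (l, q z x').
  apply: (@cvg_pair _ _ _ G (nbhs l) (nbhs (q z x'))) => //.
  by apply: (@cvg_comp _ _ _ snd li G F) => //; exact: cvg_snd.
have dl : cdom d (l (q z x')).
  by have /dE := dx; rewrite /graph_map (susp_kK sY).
have pcx : cdom (line_chart c) (q z x') by [].
have ev s := jet_eval_cvg goodRA openB s lc (line_chart_in Ac) Bd sl pcx dl.
have near1 : \forall p \near G, cdom d' (graph_map (phi (zi p.2)) (li p.2) p.1).
  have [E _] := ev [::].
  have {}E : G ((fun p => (li p.2, q (zi p.2) p.1)) @^-1` [set r | cdom d (r.1 r.2)]).
    exact: lqc E.
  by apply: filterS E => p Hp; apply/dE; rewrite /graph_map (susp_kK sY).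
split; first exact: near1.
move=> s.
have [T [HT TE]] := chart_jet_graph s.
rewrite (TE z l c' d' c d)//.
have oc' : open (cdom c') by case: (goodA' A'c').
have near2 : \forall p \near G, cdom c' p.1 /\ smooth RA B (li p.2).
  apply: filterI; first by apply: (@cvg_fst _ _ (nbhs x') F); exact: open_nbhs_nbhs.
  exact: (@cvg_snd _ _ (nbhs x') F _ _ sli).
have E : \forall p \near G,
  rcons1 (rhead_pder s (cmap c' p.1))
      (T (zi p.2) (extension (rep_dom (line_chart c) d (li p.2)) (rep (line_chart c) d (li p.2))
             (reparam (phi (zi p.2)) (cmap c' p.1))) (cmap c' p.1)) =
  chart_jet c' d' (graph_map (phi (zi p.2)) (li p.2)) s p.1.
  apply: filterS2 near1 near2 => p H1 [H2 H3].
  by rewrite (TE _ _ c' d' c d).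
apply: cvg_trans (near_eq_cvg E) _.
have cmc : cmap c' p.1 @[p --> G] --> cmap c' x'.
  apply: (@cvg_comp _ _ _ fst (cmap c') G (nbhs x')); first exact: cvg_fst.
  exact: cmap_cvg (goodA' A'c') cx.
apply: (@cvg_rcons1 _ _ _ G).
  by apply: (cvg_comp _ _ cmc); exact: rhead_pder_continuous.
apply: (expands_cvg HT) => // s'.
have rE z0 y : cdom c' y -> reparam (phi z0) (cmap c' y) = cmap (line_chart c) (q z0 y).
  by move=> /cE[_ ->]; rewrite /reparam rcons1K rtail_rcons1.
have := cvg_comp _ _ lqc (ev s').2.
rewrite /chart_jet /jet -(rE z x' cx).
apply: cvg_trans; apply: near_eq_cvg.
by apply: filterS near2 => p [cp _] /=; rewrite rE.
Qed.

(** The derivative is block triangular. The first coordinate of the graph is the first coordinate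
    itself, so a kernel vector has first entry 0, whatever the derivative of [phi z]; its tail is
    then in the kernel of the derivative of the slice at time [phi z (rhead v)]. *)
Lemma immersion_graph z l : smooth RA B l ->
  (forall t, immersion A B (fun x => l (t, x))) ->
  immersion A' B' (graph_map (phi z) l).
Proof.
move=> sl il c' d' A'c' B'd' v Dv.
have [c [d M]] := matching_chartsP A'c' B'd'.
have [Ac Bd cE dE mE] := M.
have Dw := (mE (phi z) l v).2.1 Dv.
have [g gP] := sl.2 _ d (line_chart_in Ac) Bd _ Dw.
have GP := local_extension_graph M gP.
have [cG sG] := smooth_graph z sl.
have fG := fat_rep_dom (goodA' A'c') (openB' B'd') cG.
have [U [oU Uv Cg Eg]] := gP.
have [V [oV Vv CE _]] := extensionP GP.
set t := phi z (rhead v) in Uv *.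
have wE : reparam (phi z) v = rcons1 t (rtail v) by [].
have ct := slice_continuous (t := t) sl.1.
pose lt x := l (t, x).
rewrite wE in Dw gP.
have Dt : rep_dom c d lt (rtail v) by apply/rep_dom_slice.
have gtP := local_extension_slice gP.
have [V' [oV' V'v CE' _]] := extensionP gtP.
apply: raddf_inj => u Hu.
have H := etrans (esym (Cinf_diff oV CE Vv u)) Hu.
have pE i := pder_graph [:: i] (@open_reparam _ _ _ _ phiS z U oU)
  (Cinf_on_reparam phiS oU Cg) Uv.
have EE i : pder [:: i] (extension (rep_dom c' d' (graph_map (phi z) l))
    (rep c' d' (graph_map (phi z) l)) v) v =
    rcons1 ((delta_mx 0 i : 'rV[R]_a.+1) 0 ord0) (pder [:: i] (g \o reparam (phi z)) v).
  by rewrite (local_extension_pder [:: i] fG Dv (extensionP GP) GP) pE.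
have {}H : rcons1 (u 0 ord0) (\sum_i u 0 i *: pder [:: i] (g \o reparam (phi z)) v) = 0.
  rewrite -H; apply: rcons1_rect => [|i].
    rewrite rcons1_0 summxE (bigD1 ord0)// big1 => [|i i0].
      by rewrite EE mxE rcons1_0 mxE !eqxx mulr1 /= addr0.
    by rewrite EE mxE rcons1_0 mxE /= [ord0 == i]eq_sym (negbTE i0) mulr0.
  rewrite rcons1_lift !summxE; apply: eq_bigr => k _.
  by rewrite [LHS]mxE [RHS]mxE EE rcons1_lift.
have u0 : u 0 ord0 = 0.
  by have := congr1 (fun w : 'rV_b.+1 => w 0 ord0) H; rewrite rcons1_0 mxE.
have {}H : \sum_i u 0 i *: pder [:: i] (g \o reparam (phi z)) v = 0.
  apply/rowP => i; have := congr1 (fun w : 'rV_b.+1 => w 0 (lift ord0 i)) H.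
  by rewrite rcons1_lift !mxE.
have {}H : 'd (rep_ext c d lt (rtail v)) (rtail v) (rtail u) = 0.
  rewrite (Cinf_diff oV' CE' V'v) -[RHS]H [RHS]big_ord_recl u0 scale0r add0r.
  apply: eq_bigr => i _; rewrite rtailE; congr (_ *: _).
  have ft := fat_rep_dom (goodA Ac) (openB Bd) ct.
  rewrite (local_extension_pder [:: i] ft Dt (extensionP gtP) gtP).
  rewrite (pder_slice [:: i] oU Cg) /= -?wE//.
  have Dg := (Cg [::] _ Uv).2 (lift ord0 i).
  by have [_ <-] := is_derive_reparam_lift Dg.
have tu : rtail u = 0.
  by apply: (il t c d Ac Bd (rtail v) Dt); rewrite [RHS]raddf0; exact: H.
rewrite -[u]rcons1_eta tu /rhead u0; apply: rcons1_rect => [|i].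
  by rewrite rcons1_0 mxE.
by rewrite rcons1_lift !mxE.
Qed.

End Family.

End Graph.

(** * Homotopies and proper embeddings *)

Lemma proper_embedding (X Y : topologicalType) (f : X -> Y) :
  hausdorff_space Y -> continuous f -> injective f ->
  (forall y : Y, exists V K, [/\ nbhs y V, compact K & f @^-1` V `<=` K]) ->
  topological_embedding f.
Proof.
move=> hY cf fI fP; split=> // U oU; exists (~` (f @` (~` U))); last first.
  apply/seteqP; split=> x /=; first by move=> Ux [z nUz /fI zx]; apply: nUz; rewrite zx.
  by move=> H; apply: contrapT => nUx; apply: H; exists x.
rewrite openE => y yV; have [V [K [yVn cK VK]]] := fP y.
have cC : closed (f @` (~` U `&` K)).
  apply: compact_closed => //; apply: continuous_compact.
    exact: continuous_subspaceT.
  by rewrite setIC; apply: compact_closedI => //; exact: open_closedC.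
have yC : nbhs y (~` (f @` (~` U `&` K))).
  apply: open_nbhs_nbhs; split; first exact: closed_openC.
  by move=> [x [nUx _] xy]; apply: yV; exists x.
apply: filterS (filterI yVn yC) => z [Vz nz] [x nUx xz].
by apply: nz; exists x => //; split => //; apply: VK; rewrite /= xz.
Qed.

Section Clamp.
Context {R : realType}.
Implicit Types r : R.

Definition clamp r : R := Num.max 0 (Num.min r 1).

Lemma clamp_itv r : 0 <= clamp r <= 1.
Proof. by rewrite /clamp le_max lexx /= ge_max ler01 /= ge_min lexx orbT. Qed.

Lemma clamp_continuous : continuous clamp.
Proof.
move=> r.
have m : {for r, continuous ((fun s : R => s : R^o) \min (fun=> 1))}.
  by apply: continuous_min; [exact: cvg_id | exact: cvg_cst].
have M : {for r, continuous ((fun=> 0 : R^o) \max ((fun s : R => s : R^o) \min (fun=> 1)))}.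
  by apply: continuous_max => //; exact: cvg_cst.
exact: M.
Qed.

Lemma clampE r : 0 <= r <= 1 -> clamp r = r.
Proof. by move=> /andP[r0 r1]; rewrite /clamp (min_idPl r1) (max_idPr r0). Qed.

Lemma clamp_le0 r : r <= 0 -> clamp r = 0.
Proof. by move=> r0; rewrite /clamp; apply/max_idPl; rewrite ge_min r0. Qed.

Lemma clamp_ge1 r : 1 <= r -> clamp r = 1.
Proof. by move=> r1; rewrite /clamp (min_idPr r1); apply/max_idPr. Qed.

End Clamp.

(** With [clamp] inserted, [K1] and [K2] are each continuous on the whole of [0,1] x A. At the seam
    1/2 both equal [g], so the pasted map converges there because both branches do. *)
Lemma homotopic_trans (R : realType) (S T : topologicalType) (A : set S) (B : set T)
    (f g h : S -> T) :
  homotopic R A B f g -> homotopic R A B g h -> homotopic R A B f h.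
Proof.
move=> [H1 [cH1 BH1 H10 H11]] [H2 [cH2 BH2 H20 H21]].
pose K1 (p : R * S) := H1 (clamp (2 * p.1), p.2).
pose K2 (p : R * S) := H2 (clamp (2 * p.1 - 1), p.2).
pose D : set (R * S) := `[0, 1]%classic `*` A.
have cK (H : R * S -> T) (k : R -> R) : continuous k -> {within D, continuous H} ->
    forall p, D p -> H (clamp (k q.1), q.2) @[q --> within D (nbhs p)] --> H (clamp (k p.1), p.2).
  move=> ck cH p [Dp1 Dp2].
  apply: (@cvg_comp _ _ _ (fun q => (clamp (k q.1), q.2)) H (within D (nbhs p))
    (within D (nbhs (clamp (k p.1), p.2)))); last first.
    by move/subspace_continuousP : cH; apply; split => //=; rewrite in_itv; exact: clamp_itv.
  move=> N HN.
  have Q : (fun q : R * S => (clamp (k q.1), q.2)) @ (nbhs p) --> (clamp (k p.1), p.2).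
    apply: (@cvg_pair _ _ _ (nbhs p) (nbhs (clamp (k p.1)))); last exact: cvg_snd.
    apply: (@cvg_comp _ _ _ fst (clamp \o k) (nbhs p) (nbhs p.1)); first exact: cvg_fst.
    by apply: (@cvg_comp _ _ _ k clamp (nbhs p.1) (nbhs (k p.1))); [exact: ck | exact: clamp_continuous].
  have Q' : \forall q \near p, D (clamp (k q.1), q.2) -> N (clamp (k q.1), q.2) := Q _ HN.
  by apply: filterS Q' => q Hq [_ Aq]; apply: Hq; split => //=; rewrite in_itv; exact: clamp_itv.
have cK1 p : D p -> K1 q @[q --> within D (nbhs p)] --> K1 p.
  apply: (cK H1 (fun r => 2 * r)) => //.
  by move=> r; apply: cvgM; [exact: cvg_cst | exact: cvg_id].
have cK2 p : D p -> K2 q @[q --> within D (nbhs p)] --> K2 p.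
  apply: (cK H2 (fun r => 2 * r - 1)) => //.
  move=> r; apply: cvgB; last exact: cvg_cst.
  by apply: cvgM; [exact: cvg_cst | exact: cvg_id].
have K12 p : p.1 = 2^-1 -> A p.2 -> K1 p = K2 p.
  move=> pE Ap; rewrite /K1 /K2 pE mulfV// subrr clamp_ge1// clamp_le0//.
  by rewrite H11// H20.
exists (fun p => if p.1 <= 2^-1 then K1 p else K2 p); split.
- apply/subspace_continuousP => p Dp.
  have near_fst (P : set R) : nbhs p.1 P -> \forall q \near within D (nbhs p), P q.1.
    by move=> HP; apply: cvg_within; exact: (@cvg_fst _ _ (nbhs p.1) (nbhs p.2)).
  have [lt|gt|eq] := ltgtP p.1 2^-1.
  + rewrite /from_subspace ltW//; apply: cvg_trans (cK1 p Dp); apply: near_eq_cvg.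
    by apply: filterS (near_fst _ (lt_nbhsl lt)) => q; move=> /ltW ->.
  + rewrite /from_subspace leNgt gt /=; apply: cvg_trans (cK2 p Dp); apply: near_eq_cvg.
    by apply: filterS (near_fst _ (lt_nbhsr gt)) => q; rewrite leNgt => ->.
  + rewrite /from_subspace eq lexx => N NK1.
    have N1 : \forall q \near within D (nbhs p), N (K1 q) := cK1 p Dp N NK1.
    have NK2 : nbhs (K2 p) N by rewrite -K12//; case: Dp.
    have N2 : \forall q \near within D (nbhs p), N (K2 q) := cK2 p Dp N NK2.
    apply: filterS2 N1 N2 => q /= Q1 Q2.
    by case: ifP.
- move=> r x r01 Ax /=; case: ifP => _; [apply: BH1 | apply: BH2] => //;
    rewrite in_itv; exact: clamp_itv.
- by move=> x Ax /=; rewrite invr_ge0 ler0n /K1 /= mulr0 clamp_le0// H10.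
- move=> x Ax /=; rewrite ifN.
    by rewrite /K2 /= mulr1 clamp_ge1 ?H21//; lra.
  by rewrite -ltNge invf_lt1// ltr1n.
Qed.

Lemma compact_open_eval (T U : topologicalType) (t : T) :
  continuous (fun f : {compact-open, T -> U} => f t).
Proof.
move=> f N; rewrite nbhsE => -[V [oV Vf] VN].
have : nbhs (f : {compact-open, T -> U}) [set g | g @` [set t] `<=` V].
  apply: open_nbhs_nbhs; split; first by apply: compact_open_open => //; exact: compact_set1.
  by move=> _ [_ -> <-].
by apply: filterS => g gV; apply: VN; apply: gV; exists t.
Qed.

(** * The connecting map *)

Section SmoothLoops.
Context {R : realType} {X Y : topologicalType} {a b : nat}.
Variables (A : atlas R X a) (B : atlas R Y b).
Hypotheses (goodA : forall c, A c -> good_chart c)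
  (openB : forall d, B d -> open (cdom d)) (hausY : hausdorff_space Y).
Variables (S : set (weakCinf A B)) (f0 : weakCinf A B).
Hypothesis smoothS : forall f, S f -> smooth A B f.
Local Notation RA := (prod_atlas (real_line R) A).

(** The definition fixes the loop outside the closed interval only; at the times -1 and 1 the value
    is a one-sided limit, unique since Y is Hausdorff. *)
Lemma smooth_loop_base (l : weakCinf RA B) t x : smooth_loops S f0 l ->
  t <= -1 \/ 1 <= t -> l (t, x) = f0 x.
Proof.
move=> [sl _ bl] ht.
have cl : (l (s, x)) @[s --> t] --> l (t, x).
  apply: (@cvg_comp _ _ _ (fun s => (s, x)) l (nbhs t) (nbhs (t, x))); last exact: sl.1.
  by apply: (@cvg_pair _ _ _ (nbhs t) (nbhs t)); [exact: cvg_id | exact: cvg_cst].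
have E s : s \notin `[-1, 1] -> l (s, x) = f0 x by move/bl => <-.
case: ht => ht.
- apply: (@cvg_unique _ hausY (l (s, x) @[s --> t^'-])).
    exact: cvg_within_filter cl.
  apply: cvg_near_cst; near=> s; rewrite E// in_itv /= negb_and -ltNge.
  by rewrite (lt_le_trans _ ht)//; near: s; exact: nbhs_left_lt.
- apply: (@cvg_unique _ hausY (l (s, x) @[s --> t^'+])).
    exact: cvg_within_filter cl.
  apply: cvg_near_cst; near=> s; rewrite E// in_itv /= negb_and orbC -ltNge.
  by rewrite (le_lt_trans ht)//; near: s; exact: nbhs_right_gt.
Unshelve. all: by end_near. Qed.

(** A jet of the slice at time t is a jet of [l] in the X-directions, which is continuous on R x X.
    This places [loop_of l] among the continuous loops on which connecting maps are specified. *)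
Lemma loop_of_continuous (l : weakCinf RA B) : smooth_loops S f0 l ->
  continuous (loop_of l : R -> weakCinf A B).
Proof.
move=> [sl Sl _] t.
have goodRA c : RA c -> good_chart c by exact: good_suspension (suspension_id A) goodA c.
apply: (@cvg_weakCinf_jets _ _ _ _ _ A B goodA openB _ (nbhs t)) => //; first exact: smoothS (Sl t).
move=> c d x Ac Bd cx dx.
have swap : (p.2, p.1) @[p --> (nbhs x, nbhs t)] --> (t, x).
  by apply: (@cvg_pair _ _ _ (filter_prod (nbhs x) (nbhs t)) (nbhs t));
    [exact: cvg_snd | exact: cvg_fst].
have od := openB Bd.
have near1 : \forall p \near (nbhs x, nbhs t), cdom d (l (p.2, p.1)).
  have H : nbhs (t, x) (l @^-1` cdom d) by apply: sl.1; exact: open_nbhs_nbhs.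
  exact: swap H.
split; first exact: near1.
move=> s.
have E t' y : cdom c y -> cdom d (l (t', y)) ->
    chart_jet c d (loop_of l t') s y = chart_jet (line_chart c) d l (map (lift ord0) s) (t', y).
  move=> cy dy.
  have cE : cmap (line_chart c) (t', y) = rcons1 t' (cmap c y) by [].
  have Dl : rep_dom (line_chart c) d l (rcons1 t' (cmap c y)).
    by apply/(rep_domE (x := (t', y)) _ _ (goodRA _ (line_chart_in Ac))).
  have [g0 /extensionP gP] := sl.2 _ d (line_chart_in Ac) Bd _ Dl.
  have gtP := local_extension_slice gP.
  have Dt : rep_dom c d (loop_of l t') (cmap c y) by apply/rep_dom_slice.
  have ft : fat (rep_dom c d (loop_of l t')).
    by apply: fat_rep_dom => //; [exact: goodA | exact: slice_continuous sl.1].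
  rewrite /chart_jet (jetE s ft Dt gtP) cE /jet.
  by have [U [oU Uy Cg _]] := gP; rewrite (pder_slice s oU Cg).
have near2 : \forall p \near (nbhs x, nbhs t), cdom c p.1.
  have H : nbhs x (cdom c) by have [oc _ _ _ _] := goodA Ac; exact: open_nbhs_nbhs.
  exact: (@cvg_fst _ _ (nbhs x) (nbhs t) _ _ H).
rewrite E//.
have J : chart_jet (line_chart c) d l (map (lift ord0) s) p @[p --> (t, x)] -->
    chart_jet (line_chart c) d l (map (lift ord0) s) (t, x).
  by apply: (chart_jet_cvg goodRA openB) => //; exact: line_chart_in.
apply: cvg_trans (cvg_comp _ _ swap J); apply: near_eq_cvg.
apply: filterS2 near1 near2 => p H1 H2 /=.
by rewrite -E.
Qed.

End SmoothLoops.

(** * The connecting map of a fibration whose paths lift by graphs *)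

Section ConnectingMapGraph.
Context {R : realType} {X Y X' Y' : topologicalType} {a b : nat}.
Variables (A : atlas R X a) (B : atlas R Y b) (A' : atlas R X' a.+1) (B' : atlas R Y' b.+1).
Variables (hX : X' -> R * X) (kX : R * X -> X') (hY : Y' -> R * Y) (kY : R * Y -> Y').
Hypotheses (sX : suspension A A' hX kX) (sY : suspension B B' hY kY).
Hypotheses (goodA : forall c, A c -> good_chart c)
  (openB : forall d, B d -> open (cdom d)) (hausY : hausdorff_space Y)
  (lcRX : small_compact_nbhds (R * X)%type).
Variables (S : set (weakCinf A B)) (f0 : weakCinf A B)
  (E F : set (weakCinf A' B')) (e : weakCinf A' B') (p : weakCinf A' B' -> weakCinf A B).
Hypothesis smoothS : forall f, S f -> smooth A B f.
Local Notation RA := (prod_atlas (real_line R) A).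
Local Notation L := (smooth_loops S f0).
Local Notation graph phi l := (graph_map hX kY phi l : weakCinf A' B').

(** The four hypotheses isolate the geometry of the two fibrations. The time [tau] is where the
    reparametrization comes to rest, so the slice of [l] at [tau] is the image in the base; for the
    fibre it has to end at or beyond time 1. *)
Hypothesis graph_E : forall (phi : R -> R -> R) z tau l, L l -> smooth_family phi ->
  (forall t, t <= -1 -> phi z t <= -1) -> (forall t, 1 <= t -> phi z t = tau) ->
  E (graph (phi z) l).
Hypothesis graph_F : forall (phi : R -> R -> R) z l, L l -> smooth_family phi ->
  (forall t, t <= -1 -> phi z t <= -1) -> (forall t, 1 <= t -> 1 <= phi z t) ->
  F (graph (phi z) l).
Hypothesis graph_e : forall (phi : R -> R) l, L l -> (forall t, phi t <= -1) ->
  graph phi l = e.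
Hypothesis graph_p : forall (phi : R -> R) l, p (graph phi l) = fun x => l (phi 1, x).

(** The final value [-1 + 2 * z] inverts the change of variable [(t + 1) / 2] of [project_path];
    [clamp] makes the path constant outside [0,1], as [homotopy_fibre] demands. *)
Let ramp (z t : R) : R := -1 + 2 * clamp z * step t.
Let slide (r t : R) : R := (1 - r) * ramp 1 t + r * t.

Let ramp_smooth : smooth_family ramp.
Proof.
apply: smooth_familyD; first exact: smooth_family_cst.
apply: smooth_familyM; last exact: smooth_step.
apply: smooth_family_param => z; apply: cvgM; first exact: cvg_cst.
exact: clamp_continuous.
Qed.

Let slide_smooth : smooth_family slide.
Proof.
apply: smooth_familyD; apply: smooth_familyM.
- by apply: smooth_family_param => z; apply: cvgB; [exact: cvg_cst | exact: cvg_id].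
- apply: smooth_familyD; first exact: smooth_family_cst.
  by apply: smooth_familyM; [exact: smooth_family_cst | exact: smooth_step].
- by apply: smooth_family_param => z; exact: cvg_id.
- by move=> r; exact: Cfam_id.
Qed.

Let ramp_le z t : t <= -1 -> ramp z t = -1.
Proof. by move=> t1; rewrite /ramp step_le// mulr0 addr0. Qed.

Let ramp_ge z t : 1 <= t -> ramp z t = -1 + 2 * clamp z.
Proof. by move=> t1; rewrite /ramp step_ge// mulr1. Qed.

Let path (l : weakCinf RA B) : {compact-open, R -> weakCinf A' B'} :=
  fun z => graph (ramp z) l.

Let path_fibre l : L l -> homotopy_fibre E F e (path l).
Proof.
move=> Ll; have [sl _ _] := Ll; split.
- move=> z; apply: (graph_cvg sX sY goodA openB ramp_smooth (nbhs_filter z)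
    (zi := id) (li := fun _ => l)) => //; [exact: cvg_cst | exact: filterE].
- move=> z; apply: (graph_E (tau := -1 + 2 * clamp z)) => // t t1.
    by rewrite ramp_le.
  by rewrite ramp_ge.
- move=> z z0; apply: graph_e => // t.
  by rewrite /ramp clamp_le0// mulr0 mul0r addr0.
- by move=> z z1; rewrite /path /ramp (clamp_ge1 z1) clamp_ge1.
- apply: graph_F => // t t1; first by rewrite ramp_le.
  by rewrite ramp_ge// clamp_ge1//; lra.
Qed.

Let project_pathE l : L l -> project_path p (path l) = loop_of l.
Proof.
move=> Ll; apply/funext => t; rewrite /project_path /path graph_p /loop_of.
apply/funext => x; rewrite ramp_ge//.
(* Outside [-1,1] clamping moves the loop time to an endpoint, but there the loop is at its
   base-point as well. *)
have [t1|t1] := leP t (-1).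
  by rewrite clamp_le0 ?mulr0 ?addr0; [rewrite !(smooth_loop_base hausY _ Ll)//; left|lra].
have [t2|t2] := leP 1 t.
  by rewrite clamp_ge1; [rewrite !(smooth_loop_base hausY _ Ll)//; right; lra|lra].
by rewrite clampE; [congr (l (_, _)); lra|lra].
Qed.

(** Compact-open convergence follows from joint convergence in [(z, l)] and a covering argument in
    [z]; staying within [L] guarantees that the nearby loops are smooth. *)
Let path_cvg l0 : L l0 -> path l @[l --> within L (nbhs l0)] --> path l0.
Proof.
move=> Ll0; apply/compact_open_cvgP => K U cK oU KU.
move/compact_near_coveringP : cK => /(_ _ (within L (nbhs l0)) (fun l z => U (path l z))) H.
have {}H := H _.
suff : \forall l \near within L (nbhs l0), K `<=` (fun z => U (path l z)).
  by apply: filterS => l Hl _ [z Kz <-]; exact: Hl.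
apply: H => z Kz.
have [sl0 _ _] := Ll0.
have HG : graph (ramp q.1) q.2 @[q --> filter_prod (nbhs z) (within L (nbhs l0))] -->
    graph (ramp z) l0.
  apply: (graph_cvg sX sY goodA openB ramp_smooth) => //.
  - exact: cvg_fst.
  - by apply: cvg_trans cvg_snd _; exact: cvg_within.
  - apply: (@cvg_snd _ _ (nbhs z) (within L (nbhs l0)) _ (smooth RA B)).
    by apply: filterS (@withinT _ (nbhs l0) L _) => l [].
apply: HG; apply: open_nbhs_nbhs; split => //.
by apply: KU; exists z.
Qed.

Lemma connecting_map_graph d :
  connecting_map E F e S f0 p d ->
  homotopic R L F (fun l => d (loop_of l)) (fun l => graph id l).
Proof.
move=> [s [[cs sL] _ [H [cH HF H0 H1]] ds]].
apply: (@homotopic_trans _ _ _ _ _ _ (fun l : weakCinf RA B => graph (ramp 1) l)).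
  (* [H] deforms [s \o project_path] to the identity. Applied to [path l] and evaluated at 1, it
     starts at [s (loop_of l) 1], which is [d (loop_of l)], ends at [path l 1], and stays in the
     fibre because paths in [homotopy_fibre] end there. *)
  exists (fun q => H (q.1, path q.2) 1); split.
  - apply/subspace_continuousP => -[r l] [/= r01 Ll].
    rewrite /from_subspace /=.
    set D := `[0, 1]%classic `*` L.
    pose D' : set (R * {compact-open, R -> weakCinf A' B'}) :=
      `[0, 1]%classic `*` homotopy_fibre E F e.
    have c1 : q.1 @[q --> within D (nbhs (r, l))] --> r.
      by apply: (@cvg_within_filter _ _ _ (nbhs (r, l))); exact: cvg_fst.
    have c2 : path q.2 @[q --> within D (nbhs (r, l))] --> path l.
      apply: (@cvg_comp _ _ _ snd path (within D (nbhs (r, l))) (within L (nbhs l)));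
        last exact: path_cvg.
      move=> N NN.
      have S2 : q.2 @[q --> within D (nbhs (r, l))] --> l.
        by apply: (@cvg_within_filter _ _ _ (nbhs (r, l))); exact: cvg_snd.
      have N2 : \forall q \near within D (nbhs (r, l)), L q.2 -> N q.2 := S2 _ NN.
      have N3 : \forall q \near within D (nbhs (r, l)), D q by exact: withinT.
      have K : \forall q \near within D (nbhs (r, l)), N q.2.
        by apply: filterS2 N2 N3 => q Nq [_ ?]; exact: Nq.
      exact: K.
    have c12 : (q.1, path q.2) @[q --> within D (nbhs (r, l))] --> (r, path l).
      exact: (@cvg_pair _ _ _ (within D (nbhs (r, l))) (nbhs r) (nbhs (path l))).
    (* [H] is continuous only on [0,1] x [homotopy_fibre], so the limit has to be taken within that
       set. *)
    have c12' : (q.1, path q.2) @[q --> within D (nbhs (r, l))] -->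
        within D' (nbhs (r, path l)).
      move=> N NN.
      have N2 : \forall q \near within D (nbhs (r, l)), D' (q.1, path q.2) -> N (q.1, path q.2).
        exact: c12 NN.
      have N3 : \forall q \near within D (nbhs (r, l)), D q by exact: withinT.
      have K : \forall q \near within D (nbhs (r, l)), N (q.1, path q.2).
        by apply: filterS2 N2 N3 => q Nq [? ?]; apply: Nq; split => //; exact: path_fibre.
      exact: K.
    have cHp : H q @[q --> within D' (nbhs (r, path l))] --> H (r, path l).
      by move/subspace_continuousP : cH; apply; split => //; exact: path_fibre.
    exact: (cvg_comp _ _ (cvg_comp _ _ c12' cHp) (@compact_open_eval _ _ (1 : R) (H (r, path l)))).
  - move=> r l r01 Ll /=.
    by have [_ _ _ _] := HF r (path l) r01 (path_fibre Ll).
  - move=> l Ll /=; rewrite H0; last exact: path_fibre.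
    rewrite /= (project_pathE Ll) ds//.
    have [sl Sl bl] := Ll.
    split => //.
    exact: loop_of_continuous Ll.
  - by move=> l Ll /=; rewrite H1//; exact: path_fibre.
exists (fun q => graph (slide q.1) q.2); split.
- apply/subspace_continuousP => -[r l] [/= r01 Ll].
  rewrite /from_subspace /=.
  set D := `[0, 1]%classic `*` L.
  apply: (graph_cvg sX sY goodA openB slide_smooth) => //.
  - by apply: (@cvg_within_filter _ _ _ (nbhs (r, l))); exact: cvg_fst.
  - by apply: (@cvg_within_filter _ _ _ (nbhs (r, l))); exact: cvg_snd.
  - by apply: filterS (@withinT _ (nbhs (r, l)) D _) => q [_ []].
  - by have [] := Ll.
(* The conditions of [graph_F] are convex in the reparametrization, and both [ramp 1] and the
   identity satisfy them. *)
- move=> r l; rewrite in_itv /= => /andP[r0 r1] Ll; apply: graph_F => // t t1.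
    rewrite /slide ramp_le//; nra.
  rewrite /slide ramp_ge// clamp_ge1//; nra.
- move=> l Ll; congr (graph_map hX kY _ l); apply/funext => t.
  by rewrite /slide subr0 mul1r mul0r addr0.
- move=> l Ll; congr (graph_map hX kY _ l); apply/funext => t.
  by rewrite /slide subrr mul0r add0r mul1r.
Qed.

End ConnectingMapGraph.

(** * Euclidean and product atlases *)

Section SmallCompact.

Lemma hausdorff_prod (T U : topologicalType) :
  hausdorff_space T -> hausdorff_space U -> hausdorff_space (T * U)%type.
Proof.
move=> hT hU [x1 x2] [y1 y2] cl; congr (_, _).
  apply: hT => P Q Px Qy.
  have [||z [[Pz _] [Qz _]]] := cl (P `*` setT) (Q `*` setT); [| |by exists z.1].
    by exists (P, setT) => //; split => //; exact: filterT.
  by exists (Q, setT) => //; split => //; exact: filterT.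
apply: hU => P Q Px Qy.
have [||z [[_ Pz] [_ Qz]]] := cl (setT `*` P) (setT `*` Q); [| |by exists z.2].
  by exists (setT, P) => //; split => //; exact: filterT.
by exists (setT, Q) => //; split => //; exact: filterT.
Qed.

Lemma small_compact_nbhds_of (T : topologicalType) : hausdorff_space T ->
  (forall x : T, exists2 V, compact V & nbhs x V) -> small_compact_nbhds T.
Proof.
move=> hT H x N Nx; have [V cV Vx] := H x.
have [W Wx WN] := compact_regular hT cV Vx Nx.
exists (V `&` closure W); split.
- by apply: compact_closedI => //; exact: closed_closure.
- by apply: filterI => //; apply: filterS Wx; exact: subset_closure.
- by move=> y [_ /WN].
Qed.

Lemma small_compact_nbhds_prod (T U : topologicalType) :
  small_compact_nbhds T -> small_compact_nbhds U -> small_compact_nbhds (T * U)%type.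
Proof.
move=> hT hU [x y] N [[P Q] [/= Px Qy] PQ].
have [K [cK Kx KP]] := hT x P Px; have [K' [cK' Ky KQ]] := hU y Q Qy.
exists (K `*` K'); split; first exact: compact_setX.
  by exists (K, K').
by move=> z [Kz1 Kz2]; apply: PQ; split; [exact: KP | exact: KQ].
Qed.

Lemma compact_closed_ball (R : realType) n (r : R) :
  compact [set x : 'rV[R]_n | `|x| <= r].
Proof.
apply: bounded_closed_compact.
  exists r; split; first exact: num_real.
  by move=> M rM x xr; apply: le_trans xr (ltW rM).
apply: (@closed_comp _ _ (fun x : 'rV[R]_n => `|x|) [set s | s <= r]).
  by move=> x _; exact: norm_continuous.
exact: closed_le.
Qed.

Lemma hausdorff_row (R : realType) n : hausdorff_space 'rV[R]_n.
Proof. exact: norm_hausdorff. Qed.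

Lemma small_compact_nbhds_row (R : realType) n : small_compact_nbhds 'rV[R]_n.
Proof.
apply: small_compact_nbhds_of => [|x]; first exact: hausdorff_row.
exists [set y : 'rV[R]_n | `|y| <= `|x| + 1]; first exact: compact_closed_ball.
have c : `|y| @[y --> x] --> `|x| by exact: norm_continuous.
apply: (c [set s | s <= `|x| + 1]).
have lt1 : `|x| < `|x| + 1 by rewrite ltrDl.
by apply: filterS (lt_nbhsl lt1) => s /ltW.
Qed.

Lemma small_compact_nbhdsR (R : realType) : small_compact_nbhds R.
Proof.
apply: small_compact_nbhds_of => [|x]; first exact: Rhausdorff.
exists (closed_ball x 1); first exact: closed_ballR_compact.
by apply: filterS (nbhsx_ballx x _ ltr01); exact: subset_closed_ball.
Qed.

End SmallCompact.

Section ConcreteAtlases.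
Context {R : realType}.

Lemma row_mx_rcons1 j k (x : 'rV[R]_j.+1) (y : 'rV[R]_k) :
  row_mx x y = rcons1 (rhead x) (row_mx (rtail x) y).
Proof.
apply: rcons1_rect => [|i].
  rewrite rcons1_0 /rhead -(row_mxEl x y 0 0).
  by congr (_ 0 _); apply/val_inj.
rewrite rcons1_lift; case: (split_ordP i) => [i1|i1] ->.
  rewrite row_mxEl rtailE -(row_mxEl x y 0 (lift ord0 i1)).
  by congr (_ 0 _); apply/val_inj.
rewrite row_mxEr -(row_mxEr x y 0 i1).
by congr (_ 0 _); apply/val_inj.
Qed.

Lemma good_euclid n c : euclid R n c -> good_chart c.
Proof.
move=> ->; split => /=.
- exact: openT.
- by apply: continuous_subspaceT => x; exact: cvg_id.
- by apply: continuous_subspaceT => x; exact: cvg_id.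
- by [].
- rewrite (_ : cim _ = setT); first exact/fat_open/openT.
  by rewrite eqEsubset; split => // x _; exists x.
Qed.

Lemma suspension_euclid n : suspension (euclid R n) (euclid R n.+1)
  (fun x => (rhead x, rtail x)) (fun p => rcons1 p.1 p.2).
Proof.
split.
- move=> x; apply: (@cvg_pair _ _ _ (nbhs x) (nbhs (rhead x)) (nbhs (rtail x))).
    exact: rhead_continuous.
  exact: rtail_continuous.
- move=> p; apply: (@cvg_rcons1 _ _ _ (nbhs p)); [exact: cvg_fst | exact: cvg_snd].
- by move=> x; exact: rcons1_eta.
- by move=> [t u]; rewrite rcons1K rtail_rcons1.
- move=> _ ->; exists (Chart setT id id) => //; split => //= x; by rewrite rcons1_eta.
Qed.

Context {M : topologicalType} {k : nat} (A : atlas R M k).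

Lemma good_manifold : manifold A -> forall c, A c -> good_chart c.
Proof.
move=> [_ _ _ H _] c /H[oc cc mc ci cK]; split => //; exact: fat_model.
Qed.

Lemma suspension_prod j :
  suspension (prod_atlas (euclid R j) A) (prod_atlas (euclid R j.+1) A)
    (fun p => (rhead p.1, (rtail p.1, p.2))) (fun q => (rcons1 q.1 q.2.1, q.2.2)).
Proof.
split.
- move=> p.
  apply: (@cvg_pair _ _ _ (nbhs p) (nbhs (rhead p.1)) (nbhs (rtail p.1, p.2))).
    apply: (@cvg_comp _ _ _ fst (@rhead R j) (nbhs p) (nbhs p.1)); first exact: cvg_fst.
    exact: rhead_continuous.
  apply: (@cvg_pair _ _ _ (nbhs p) (nbhs (rtail p.1)) (nbhs p.2)); last exact: cvg_snd.
  apply: (@cvg_comp _ _ _ fst (@rtail R j) (nbhs p) (nbhs p.1)); first exact: cvg_fst.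
  exact: rtail_continuous.
- move=> q.
  have c2 : r.2 @[r --> q] --> q.2 by exact: cvg_snd.
  apply: (@cvg_pair _ _ _ (nbhs q) (nbhs (rcons1 q.1 q.2.1)) (nbhs q.2.2)).
    apply: (@cvg_rcons1 _ _ _ (nbhs q)); first exact: cvg_fst.
    by apply: (cvg_comp _ _ c2); exact: cvg_fst.
  by apply: (cvg_comp _ _ c2); exact: cvg_snd.
- by move=> [x m] /=; rewrite rcons1_eta.
- by move=> [t [u m]] /=; rewrite rcons1K rtail_rcons1.
- move=> _ [_ -> [c Ac <-]].
  exists (prod_chart (Chart setT id id) c); first by eexists; [reflexivity | exists c].
  split => //=.
    by move=> [x m]; exact: row_mx_rcons1.
  move=> v; congr (_, _).
    apply: rcons1_rect => [|i].
      by rewrite rcons1_0 mxE /rhead; congr (v 0 _); exact/val_inj.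
    by rewrite rcons1_lift !mxE; congr (v _ _); exact/val_inj.
  by congr (cinv c _); apply/rowP => i; rewrite !mxE; congr (v _ _); exact/val_inj.
Qed.

(** Induction on [j], each step being a suspension. For [j = 0] the factor R^0 is a point and the
    product chart has the same image as [c]. *)
Lemma good_prod : (forall c, A c -> good_chart c) ->
  forall j c, prod_atlas (euclid R j) A c -> good_chart c.
Proof.
move=> gA; elim=> [|j IH]; last exact: good_suspension (suspension_prod j) IH.
move=> _ [_ -> [c Ac <-]].
have [oc cc ci cK fc] := gA c Ac; have gc := gA c Ac.
have E (x : 'rV[R]_0) (y : 'rV[R]_k) : row_mx x y = y.
  apply/rowP => i; rewrite -(row_mxEr x y 0 i); congr (row_mx x y _ _); exact/val_inj.
have E' (v : 'rV[R]_(0 + k)) : rsubmx v = v.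
  by apply/rowP => i; rewrite mxE; congr (v _ _); exact/val_inj.
have oP : open (setT `*` cdom c : set ('rV[R]_0 * M)).
  by rewrite setTX; apply: open_comp => // p _; exact: cvg_snd.
have imE : cim (prod_chart (Chart setT id id) c : chart R ('rV[R]_0 * M) k) = cim c.
  apply/seteqP; split=> v.
    by move=> [[x m] [_ cm] <-] /=; rewrite E; exists m.
  by move=> [m cm <-]; exists (0, m) => //=; rewrite E.
split.
- exact: oP.
- apply/subspace_continuousP => p [_ cp].
  rewrite within_interior; last by rewrite (interior_id _).1.
  rewrite /from_subspace /=; rewrite E.
  have -> : (fun q : 'rV[R]_0 * M => row_mx q.1 (cmap c q.2) : 'rV_k) =
      (fun q => cmap c q.2) by apply/funext => q; rewrite E.
  apply: (@cvg_comp _ _ _ snd (cmap c) (nbhs p) (nbhs p.2)); first exact: cvg_snd.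
  exact: cmap_cvg.
- rewrite imE; apply/subspace_continuousP => v cv; rewrite /from_subspace /=.
  apply: (@cvg_pair _ _ _ (within (cim c) (nbhs v)) (nbhs (lsubmx v)) (nbhs (cinv c (rsubmx v)))).
    rewrite (_ : lsubmx = cst (lsubmx v)); first exact: cvg_cst.
    by apply/funext => w; apply/rowP => -[].
  have -> : (fun w : 'rV[R]_(0 + k) => cinv c (rsubmx w)) = (fun w : 'rV_k => cinv c w).
    by apply/funext => w; rewrite E'.
  by rewrite E'; exact: cinv_cvg.
- move=> [x m] /set_mem[_ cm] /=; rewrite row_mxKl row_mxKr.
  by rewrite (good_cancel gc).
- by rewrite imE.
Qed.

Lemma open_cdom_prod : (forall c, A c -> good_chart c) ->
  forall j c, prod_atlas (euclid R j) A c -> open (cdom c).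
Proof. by move=> gA j c /(good_prod gA)[]. Qed.

End ConcreteAtlases.

(** * Long knots and cubically supported embeddings *)

Section Cubes.
Context {R : realType}.

(** The norm of a row is the sup norm, so the cube is the unit ball and its boundary the unit
    sphere, which is empty in dimension 0. All conditions on cubes become conditions on norms. *)
Lemma cubeE n (x : 'rV[R]_n) : cube x <-> `|x| <= 1.
Proof.
split=> [H|H i]; last exact: le_trans (le_coord_norm _ _ _) H.
by apply: mx_norm_le => // i j; rewrite (ord1 i).
Qed.

Lemma cube_boundaryE n (x : 'rV[R]_n) : cube_boundary R n x <-> `|x| = 1.
Proof.
split=> [[/cubeE x1 [i xi]]|x1].
  by apply/le_anti; rewrite x1 -xi le_coord_norm.
split; first by apply/cubeE; rewrite x1.
have [|[i j] E] := @mx_norm_neq0 R 1 n x; first by rewrite -[mx_norm x]/`|x| x1 oner_neq0.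
by exists j; rewrite -[in RHS]x1 [RHS]E (ord1 i).
Qed.

Lemma norm_rcons1 n t (u : 'rV[R]_n) : `|rcons1 t u| = Num.max `|t| `|u|.
Proof.
apply/le_anti/andP; split.
  apply: mx_norm_le => [|i j]; first by rewrite le_max normr_ge0.
  rewrite (ord1 i) le_max; case: (unliftP ord0 j) => [j'|] ->.
    by rewrite rcons1_lift le_coord_norm orbT.
  by rewrite rcons1_0 lexx.
rewrite ge_max; apply/andP; split.
  by have := le_coord_norm (rcons1 t u) 0 ord0; rewrite rcons1_0.
apply: mx_norm_le => // i j; rewrite (ord1 i).
by have := le_coord_norm (rcons1 t u) 0 (lift ord0 j); rewrite rcons1_lift.
Qed.

Lemma norm_rhead_rtail n (x : 'rV[R]_n.+1) : `|x| = Num.max `|rhead x| `|rtail x|.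
Proof. by rewrite -norm_rcons1 rcons1_eta. Qed.

Lemma std_inclE n j (u : 'rV[R]_j) (i : 'I_n) (i' : 'I_j) :
  i' = i :> nat -> std_incl n u 0 i = u 0 i'.
Proof.
move=> ii; rewrite /std_incl mxE (bigD1 i')//= big1 => [|l li].
  by rewrite !mxE ii eqxx -ii ltn_ord mulr1 addr0.
rewrite !mxE (_ : (l == i :> nat) = false) ?mulr0//.
by apply/negbTE; rewrite -ii (inj_eq val_inj).
Qed.

Lemma std_incl_out n j (u : 'rV[R]_j) (i : 'I_n) : (j <= i)%N -> std_incl n u 0 i = 0.
Proof.
move=> ji; rewrite /std_incl mxE big1// => l _; rewrite !mxE.
rewrite (_ : (l == i :> nat) = false) ?mulr0//.
by apply/negbTE; rewrite neq_ltn (leq_trans (ltn_ord l) ji).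
Qed.

Lemma std_incl_rcons1 n j t (u : 'rV[R]_j) :
  std_incl n.+1 (rcons1 t u) = rcons1 t (std_incl n u).
Proof.
apply: rcons1_rect => [|i].
  by rewrite (std_inclE _ (i' := ord0))// !rcons1_0.
rewrite rcons1_lift; have [ij|ji] := ltnP i j.
  rewrite (std_inclE _ (i' := lift ord0 (Ordinal ij)))// rcons1_lift.
  by rewrite (std_inclE _ (i' := Ordinal ij)).
by rewrite !std_incl_out.
Qed.

Lemma norm_std_incl n j (u : 'rV[R]_j) : (j <= n)%N -> `|std_incl n u| = `|u|.
Proof.
move=> jn; apply/le_anti/andP; split; apply: mx_norm_le => // i0 i; rewrite (ord1 i0).
  have [ij|ji] := ltnP i j.
    by rewrite (std_inclE _ (i' := Ordinal ij))// le_coord_norm.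
  by rewrite std_incl_out// normr0.
by rewrite -(@std_inclE n _ u (widen_ord jn i) i)// le_coord_norm.
Qed.

Lemma std_inclZ n j c (u : 'rV[R]_j) : std_incl n (c *: u) = c *: std_incl n u.
Proof. by rewrite /std_incl -scalemxAl. Qed.

End Cubes.

(** * Graphs of loops of long knots *)

Section LongKnotCase.
Context {R : realType} {n j : nat}.
Hypothesis hjn : (j <= n)%N.
Local Notation RA := (prod_atlas (real_line R) (euclid R j)).
Local Notation L := (smooth_loops (K_ R n j) (K_base R n j)).
Implicit Types (l : weakCinf RA (euclid R n)).

Lemma K_smooth f : K_ R n j f -> smooth (euclid R j) (euclid R n) f.
Proof. by move=> [[]]. Qed.

Lemma K_inj f : K_ R n j f -> injective f.
Proof. by move=> [[_ _ []]]. Qed.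

(** On the boundary of the cube the value is the limit along the ray [r *: u] as [r] decreases to 1,
    where [f] is already standard. *)
Lemma K_closed_outside f u : K_ R n j f -> 1 <= `|u| -> f u = std_incl n u.
Proof.
move=> Kf; have [[[cf _] _ _] fo _] := Kf.
have fout v : 1 < `|v| -> f v = std_incl n v.
  by move=> v1; apply: fo => /cubeE; rewrite leNgt v1.
rewrite le_eqVlt => /orP[/eqP u1|]; last exact: fout.
have c1 : f (r *: u) @[r --> (1 : R)] --> f (1 *: u).
  apply: (@cvg_comp _ _ _ (fun r : R => r *: u) f (nbhs (1 : R)) (nbhs (1 *: u))); last exact: cf.
  by apply: cvgZr_tmp; exact: cvg_id.
have c2 : r *: std_incl n u @[r --> (1 : R)] --> 1 *: std_incl n u.
  by apply: cvgZr_tmp; exact: cvg_id.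
rewrite -[u]scale1r std_inclZ.
apply: (@cvg_unique _ (@hausdorff_row R n) (f (r *: u) @[r --> (1 : R)^'+])).
  exact: cvg_within_filter c1.
have E : \forall r \near (1 : R)^'+, r *: std_incl n u = f (r *: u).
  near=> r; have r1 : 1 < r by near: r; exact: nbhs_right_gt.
  by rewrite fout ?std_inclZ// normrZ -u1 mulr1 gtr0_norm// (lt_trans ltr01).
have K : r *: std_incl n u @[r --> (1 : R)^'+] --> 1 *: std_incl n u.
  exact: cvg_within_filter c2.
rewrite /mkset; exact: cvg_trans (near_eq_cvg E) K.
Unshelve. all: by end_near. Qed.

(** A value on the boundary of I^n would also be the image of a boundary point [u'] of I^j, where
    the knot is standard; injectivity then gives [u = u']. *)
Lemma loop_norm_neq1 l t u : L l -> `|u| < 1 -> `|l (t, u)| != 1.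
Proof.
move=> [_ Kl _] u1; apply/eqP => /cube_boundaryE lb.
have Klt := Kl t; have [_ _ rb] := Klt.
have : (range (fun x => l (t, x)) `&` cube_boundary R n) (l (t, u)).
  by split => //; exists u.
rewrite rb => -[u' /cube_boundaryE u'1 E].
have : l (t, u') = l (t, u) by rewrite (K_closed_outside Klt)// u'1.
by move/(K_inj Klt) => uu; rewrite -uu u'1 ltxx in u1.
Qed.

(** The norm of [l (s, u)] is continuous in the time [s], below 1 while the loop is at its
    base-point, and never equal to 1, so it cannot exceed 1. The time -2 is one before the loop
    starts. *)
Lemma loop_norm_lt1 l t u : L l -> `|u| < 1 -> `|l (t, u)| < 1.
Proof.
move=> Ll u1; have [sl Kl bl] := Ll.
have base s : s \notin `[-1, 1] -> `|l (s, u)| < 1.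
  move=> /bl E; rewrite (_ : l (s, u) = K_base R n j u) ?norm_std_incl//.
  by rewrite -E.
have [t2|t2] := leP t (-2).
  by apply: base; rewrite in_itv /= negb_and -ltNge; apply/orP; left; lra.
rewrite ltNge; apply/negP => lt1.
have m2 : `|l (-2, u)| < 1.
  by apply: base; rewrite in_itv /= negb_and -ltNge; apply/orP; left; lra.
have cl : {within `[-2, t], continuous (fun s => `|l (s, u)|)}.
  apply: continuous_subspaceT => s.
  apply: (@cvg_comp _ _ _ (fun s => l (s, u)) (fun x => `|x|) (nbhs s) (nbhs (l (s, u)))); last exact: norm_continuous.
  apply: (@cvg_comp _ _ _ (fun s => (s, u)) l (nbhs s) (nbhs (s, u))); last exact: sl.1.
  by apply: (@cvg_pair _ _ _ (nbhs s) (nbhs s) (nbhs u)); [exact: cvg_id | exact: cvg_cst].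
have [|s _ E] := IVT (ltW t2) cl (v := 1).
  by rewrite ge_min le_max (ltW m2) lt1 orbT.
by move/eqP : E; rewrite (negbTE (loop_norm_neq1 s Ll u1)).
Qed.

Local Notation graph := (graph_map (fun x : 'rV[R]_j.+1 => (rhead x, rtail x))
  (fun q : R * 'rV[R]_n => rcons1 q.1 q.2)).

Lemma K_graphE phi l x : graph phi l x = rcons1 (rhead x) (l (phi (rhead x), rtail x)).
Proof. by []. Qed.

Lemma K_graph_embedding (Z : topologicalType) (phi : Z -> R -> R) z l :
  L l -> smooth_family phi ->
  smooth_embedding (euclid R j.+1) (euclid R n.+1) (graph (phi z) l).
Proof.
move=> Ll phiS; have [sl Kl _] := Ll.
have oE d : euclid R n d -> open (cdom d) by move=> /good_euclid[].
have sG : smooth (euclid R j.+1) (euclid R n.+1) (graph (phi z) l).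
  exact: (smooth_graph (suspension_euclid j) (suspension_euclid n) phiS z sl).
split => //.
  apply: (immersion_graph (suspension_euclid j) (suspension_euclid n) (@good_euclid R j) oE phiS) => //.
  by move=> t; have [[]] := Kl t.
apply: proper_embedding; [exact: hausdorff_row | exact: sG.1 | |].
  move=> x y; rewrite !K_graphE => E.
  have E0 : rhead x = rhead y by rewrite -(rcons1K (rhead x) (l (phi z (rhead x), rtail x))) E rcons1K.
  have := congr1 (@rtail R n) E; rewrite !rtail_rcons1 E0 => /(K_inj (Kl _)) E1.
  by rewrite -[x]rcons1_eta E0 E1 rcons1_eta.
move=> y; exists [set y' | `|y'| <= `|y| + 1], [set x | `|x| <= `|y| + 1 + 1]; split.
- have c : `|y'| @[y' --> y] --> `|y| by exact: norm_continuous.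
  have lt1 : `|y| < `|y| + 1 by rewrite ltrDl.
  by apply: (c [set s | s <= `|y| + 1]); apply: filterS (lt_nbhsl lt1) => s /ltW.
- exact: compact_closed_ball.
- move=> x /=; rewrite K_graphE norm_rcons1 ge_max => /andP[x0 x1].
  rewrite norm_rhead_rtail ge_max (le_trans x0) ?lerDl//=.
  (* Where the tail is large the slice is the standard inclusion, which preserves norms; elsewhere
     the tail is bounded by 1. In both cases [x] stays in a ball. *)
  have [u1|/ltW u1] := leP 1 `|rtail x|.
    by move: x1; rewrite (K_closed_outside (Kl _) u1) norm_std_incl// => /le_trans; apply; rewrite lerDl.
  by apply: (le_trans u1); rewrite lerDr addr_ge0.
Qed.

(** Both norms are maxima with the same first entry. If the tail has norm at least 1 the second
    entries agree too; otherwise both are below 1 and only the first entry matters. *)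
Lemma K_graph_boundary phi l x : L l -> `|graph phi l x| = 1 <-> `|x| = 1.
Proof.
move=> Ll; have [_ Kl _] := Ll.
rewrite K_graphE norm_rcons1 [in X in _ <-> X]norm_rhead_rtail.
have [u1|u1] := leP 1 `|rtail x|.
  by rewrite (K_closed_outside (Kl _) u1) norm_std_incl.
have l1 := loop_norm_lt1 (phi (rhead x)) Ll u1.
have H (a b : R) : b < 1 -> Num.max a b = 1 <-> a = 1.
  by move=> b1; split=> [|->]; [case: (leP a b) => // _ b1'; rewrite b1' ltxx in b1
    | rewrite max_l// ltW].
by rewrite (H _ _ l1) (H _ _ u1).
Qed.

Lemma K_graph_range phi l : L l ->
  range (graph phi l) `&` cube_boundary R n.+1 = graph phi l @` cube_boundary R j.+1.
Proof.
move=> Ll; apply/seteqP; split=> y.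
  move=> [[x _ <-] /cube_boundaryE xb]; exists x => //.
  by apply/cube_boundaryE/(K_graph_boundary phi x Ll).
move=> [x /cube_boundaryE xb <-]; split; first by exists x.
by apply/cube_boundaryE/K_graph_boundary.
Qed.

Lemma K_graph_std phi l x : L l ->
  1 <= `|rtail x| \/ (phi (rhead x) <= -1 \/ 1 <= phi (rhead x)) ->
  graph phi l x = std_incl n.+1 x.
Proof.
move=> Ll H; have [_ Kl _] := Ll.
rewrite K_graphE -{4}[x]rcons1_eta std_incl_rcons1; congr rcons1.
case: H => [u1|H]; first exact: K_closed_outside (Kl _) u1.
exact: (smooth_loop_base (@hausdorff_row R n) (rtail x) Ll H).
Qed.

Lemma K_graph_P (phi : R -> R -> R) z tau l : L l -> smooth_family phi ->
  (forall t, t <= -1 -> phi z t <= -1) -> (forall t, 1 <= t -> phi z t = tau) ->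
  P_ R n j (graph (phi z) l).
Proof.
move=> Ll phiS phi1 phi2; have [_ Kl _] := Ll; split.
- exact: K_graph_embedding.
- move=> x Hx; apply: K_graph_std => //.
  have [h1|/ltW h1] := leP (-1) (rhead x); last by right; left; exact: phi1.
  by left; rewrite leNgt; apply/negP => u1; apply: Hx; split => //; apply/cubeE/ltW.
- exists (fun u => l (tau, u)); first exact: Kl.
  by move=> t u t1; rewrite K_graphE rcons1K rtail_rcons1 phi2.
- exact: K_graph_range.
Qed.

Lemma K_graph_K (phi : R -> R -> R) z l : L l -> smooth_family phi ->
  (forall t, t <= -1 -> phi z t <= -1) -> (forall t, 1 <= t -> 1 <= phi z t) ->
  K_ R n.+1 j.+1 (graph (phi z) l).
Proof.
move=> Ll phiS phi1 phi2.
have std x : 1 <= `|x| -> graph (phi z) l x = std_incl n.+1 x.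
  rewrite norm_rhead_rtail le_max => /orP[|u1]; last by apply: K_graph_std => //; left.
  rewrite ler_normr => /orP[h1|h1]; apply: K_graph_std => //; right; [right|left].
    exact: phi2.
  by apply: phi1; rewrite lerNr.
split; first exact: K_graph_embedding.
  by move=> x Hx; apply: std; rewrite leNgt; apply/negP => /ltW/cubeE.
(* On the boundary of the cube the graph is standard, so the image of the boundary is the one
   required by [K_]. *)
rewrite K_graph_range//; apply/seteqP; split=> _ [x xb <-]; exists x => //;
  by rewrite std//; move/cube_boundaryE : xb => ->.
Qed.

Lemma K_connecting_map d :
  connecting_map (P_ R n j) (K_ R n.+1 j.+1) (K_base R n.+1 j.+1)
    (K_ R n j) (K_base R n j) (P_proj R n j) d ->
  homotopic R L (K_ R n.+1 j.+1) (fun l => d (loop_of l)) (K_gr1 R n j).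
Proof.
have oE c : euclid R n c -> open (cdom c) by move=> /good_euclid[].
have lc : small_compact_nbhds (R * 'rV[R]_j)%type.
  by apply: small_compact_nbhds_prod; [exact: small_compact_nbhdsR | exact: small_compact_nbhds_row].
apply: (connecting_map_graph (suspension_euclid j) (suspension_euclid n)
  (@good_euclid R j) oE (@hausdorff_row R n) lc).
- exact: K_smooth.
- exact: K_graph_P.
- exact: K_graph_K.
- move=> phi l Ll phi1; apply/funext => x.
  by apply: K_graph_std => //; right; left.
- move=> phi l; apply/funext => u.
  by rewrite /P_proj K_graphE rtail_rcons1 rcons1K rtail_rcons1.
Qed.

End LongKnotCase.

(** * Graphs of loops of cubically supported embeddings *)

Section CubicallySupportedCase.
Context {R : realType} {M : topologicalType} {k : nat} (A : atlas R M k) (j : nat).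
Hypothesis hM : compact_manifold A.
Local Notation RM := (prod_atlas (euclid R j) A).
Local Notation RM' := (prod_atlas (euclid R j.+1) A).
Local Notation L := (smooth_loops (EC A j) (EC_base A j)).
Implicit Types (l : weakCinf (prod_atlas (real_line R) RM) RM).

Local Notation graph := (graph_map
  (fun p : 'rV[R]_j.+1 * M => (rhead p.1, (rtail p.1, p.2)))
  (fun q : R * ('rV[R]_j * M) => (rcons1 q.1 q.2.1, q.2.2))).

Let goodA := good_manifold hM.1.
Let hausM : hausdorff_space M. Proof. by case: hM => -[]. Qed.

Lemma EC_smooth f : EC A j f -> smooth RM RM f.
Proof. by move=> [[]]. Qed.

Lemma EC_inj f : EC A j f -> injective f.
Proof. by move=> [[_ _ []]]. Qed.

Lemma EC_outside f x : EC A j f -> ~ cube x.1 -> f x = x.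
Proof. by move=> [_ fo] xc; apply: contrapT => /fo. Qed.

Lemma EC_graphE phi l p : graph phi l p =
  (rcons1 (rhead p.1) (l (phi (rhead p.1), (rtail p.1, p.2))).1,
   (l (phi (rhead p.1), (rtail p.1, p.2))).2).
Proof. by []. Qed.

(** Properness comes from the Euclidean factor, where the slices are the identity outside the cube,
    and from compactness of M, which lets a ball times M serve as the compact set. *)
Lemma EC_graph_embedding (Z : topologicalType) (phi : Z -> R -> R) z l :
  L l -> smooth_family phi -> smooth_embedding RM' RM' (graph (phi z) l).
Proof.
move=> Ll phiS; have [sl Kl _] := Ll.
have oE := open_cdom_prod goodA (j := j); have gE := good_prod goodA (j := j).
have sG : smooth RM' RM' (graph (phi z) l).
  exact: (smooth_graph (suspension_prod A j) (suspension_prod A j) phiS z sl).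
split => //.
  apply: (immersion_graph (suspension_prod A j) (suspension_prod A j) gE oE phiS) => //.
  by move=> t; have [[]] := Kl t.
apply: proper_embedding; [|exact: sG.1| |].
- by apply: hausdorff_prod; [exact: hausdorff_row | exact: hausM].
- move=> [x m] [y m']; rewrite !EC_graphE /= => -[E Em].
  have E0 : rhead x = rhead y.
    by have := congr1 (@rhead R j) E; rewrite !rcons1K.
  have := congr1 (@rtail R j) E; rewrite !rtail_rcons1 => E1.
  rewrite E0 in E1 Em.
  have /(EC_inj (Kl _)) [E2 ->] : l (phi z (rhead y), (rtail x, m)) = l (phi z (rhead y), (rtail y, m')).
    by rewrite (surjective_pairing (l _)) E1 Em -surjective_pairing.
  by rewrite -[x]rcons1_eta E0 E2 rcons1_eta.
move=> [y m]; exists ([set y' | `|y'| <= `|y| + 1] `*` setT),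
  ([set x : 'rV[R]_j.+1 | `|x| <= `|y| + 1 + 1] `*` setT); split.
- have c : `|y'| @[y' --> y] --> `|y| by exact: norm_continuous.
  have lt1 : `|y| < `|y| + 1 by rewrite ltrDl.
  exists ([set y' | `|y'| <= `|y| + 1], setT) => //; split; last exact: filterT.
  by apply: (c [set s | s <= `|y| + 1]); apply: filterS (lt_nbhsl lt1) => s /ltW.
- by apply: compact_setX; [exact: compact_closed_ball | exact: hM.2].
- move=> [x m'] /= [+ _]; rewrite norm_rcons1 ge_max => /andP[x0 x1].
  split => //=.
  rewrite norm_rhead_rtail ge_max (le_trans x0) ?lerDl//=.
  have [u1|u1] := leP `|rtail x| 1.
    by apply: (le_trans u1); rewrite lerDr addr_ge0.
  move: x1; rewrite (EC_outside (Kl _)) /=; last by move/cubeE; rewrite leNgt u1.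
  by move/le_trans; apply; rewrite lerDl.
Qed.

Lemma EC_graph_id phi l p : L l ->
  ~ cube (rtail p.1) \/ (phi (rhead p.1) <= -1 \/ 1 <= phi (rhead p.1)) ->
  graph phi l p = p.
Proof.
move=> Ll H; have [_ Kl _] := Ll.
have E : l (phi (rhead p.1), (rtail p.1, p.2)) = (rtail p.1, p.2).
  case: H => [u1|H]; first by rewrite (EC_outside (Kl _)).
  have hausRM := hausdorff_prod (@hausdorff_row R j) hausM.
  exact: (smooth_loop_base hausRM (rtail p.1, p.2) Ll H).
by rewrite EC_graphE E /= rcons1_eta -surjective_pairing.
Qed.

Lemma EC_graph_PEC (phi : R -> R -> R) z tau l : L l -> smooth_family phi ->
  (forall t, t <= -1 -> phi z t <= -1) -> (forall t, 1 <= t -> phi z t = tau) ->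
  PEC A j (graph (phi z) l).
Proof.
move=> Ll phiS phi1 phi2; have [_ Kl _] := Ll; split.
- exact: EC_graph_embedding.
- move=> p Hp; split.
    rewrite leNgt; apply/negP => /ltW h1; apply: Hp; apply: EC_graph_id => //.
    by right; left; exact: phi1.
  by apply: contrapT => Hc; apply: Hp; apply: EC_graph_id => //; left.
- exists (fun x => l (tau, x)); first exact: Kl.
  by move=> t u m t1; rewrite EC_graphE /= rcons1K rtail_rcons1 phi2.
Qed.

Lemma EC_graph_EC (phi : R -> R -> R) z l : L l -> smooth_family phi ->
  (forall t, t <= -1 -> phi z t <= -1) -> (forall t, 1 <= t -> 1 <= phi z t) ->
  EC A j.+1 (graph (phi z) l).
Proof.
move=> Ll phiS phi1 phi2; split; first exact: EC_graph_embedding.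
move=> p Hp; apply/cubeE; rewrite norm_rhead_rtail ge_max; apply/andP; split.
  rewrite leNgt; apply/negP; rewrite ltr_normr => /orP[|] /ltW h1; apply: Hp;
    apply: EC_graph_id => //; right; [right|left]; first exact: phi2.
  by apply: phi1; rewrite lerNr.
by apply/cubeE; apply: contrapT => Hc; apply: Hp; apply: EC_graph_id => //; left.
Qed.

Lemma EC_connecting_map d :
  connecting_map (PEC A j) (EC A j.+1) (EC_base A j.+1)
    (EC A j) (EC_base A j) (PEC_proj A j) d ->
  homotopic R L (EC A j.+1) (fun l => d (loop_of l)) (EC_gr1 A j).
Proof.
have lc : small_compact_nbhds (R * ('rV[R]_j * M))%type.
  apply: small_compact_nbhds_prod; first exact: small_compact_nbhdsR.
  apply: small_compact_nbhds_prod; first exact: small_compact_nbhds_row.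
  apply: small_compact_nbhds_of => // x; exists setT; first exact: hM.2.
  exact: filterT.
apply: (connecting_map_graph (suspension_prod A j) (suspension_prod A j)
  (good_prod goodA (j := j)) (open_cdom_prod goodA (j := j))
  (hausdorff_prod (@hausdorff_row R j) hausM) lc).
- exact: EC_smooth.
- exact: EC_graph_PEC.
- exact: EC_graph_EC.
- move=> phi l Ll phi1; apply/funext => p.
  by apply: EC_graph_id => //; right; left.
- move=> phi l; apply/funext => -[u m].
  by rewrite /PEC_proj EC_graphE /= rtail_rcons1 rcons1K rtail_rcons1 -surjective_pairing.
Qed.

End CubicallySupportedCase.

(** Here [n] and [j] stand for n-1 and j-1, so [j <= n] is the range n >= j >= 1. Quantifying over
    all [d] covers every choice of homotopy inverse in the definition of the connecting map. *)
Theorem proposition3p2 (R : realType) (n j : nat) (hjn : (j <= n)%N)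
    (M : topologicalType) (k : nat) (A : atlas R M k)
    (hM : compact_manifold A) :
  (forall d : {compact-open, R -> weakCinf (euclid R j) (euclid R n)} ->
              weakCinf (euclid R j.+1) (euclid R n.+1),
     connecting_map (P_ R n j) (K_ R n.+1 j.+1) (K_base R n.+1 j.+1)
       (K_ R n j) (K_base R n j) (P_proj R n j) d ->
     homotopic R (smooth_loops (K_ R n j) (K_base R n j))
       (K_ R n.+1 j.+1)
       (fun l => d (loop_of l)) (K_gr1 R n j)) /\
  (forall d : {compact-open, R -> weakCinf (prod_atlas (euclid R j) A)
                                           (prod_atlas (euclid R j) A)} ->
              weakCinf (prod_atlas (euclid R j.+1) A)
                       (prod_atlas (euclid R j.+1) A),
     connecting_map (PEC A j) (EC A j.+1) (EC_base A j.+1)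
       (EC A j) (EC_base A j) (PEC_proj A j) d ->
     homotopic R (smooth_loops (EC A j) (EC_base A j))
       (EC A j.+1)
       (fun l => d (loop_of l)) (EC_gr1 A j)).
Proof.
split=> d; [exact: K_connecting_map | exact: EC_connecting_map].
Qed.
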